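(* Let $A\in\mathbb C^{5\times 5}$ be a reciprocal matrix with superdiagonal entries $b_j$ and subdiagonal entries $c_j=b_j^{-1}$, and let $A_j=\frac12(|b_j|^2+|c_j|^2)$ for $j=1,\dots,4$ (so $A_j\ge 1$). Then the numerical range $W(A)$ is elliptical if and only if $$A_1=A_4\quad\text{or}\quad A_1-A_4=2(A_3-A_2),$$ and at least one of the inequalities $A_j\ge 1$ ($j=1,\dots,4$) is strict. Moreover, in this case the Kippenhahn curve $C(A)$ is the union of the origin and two nested axis-aligned ellipses centered at the origin.
   Context: The numerical range of $A\in\mathbb C^{n\times n}$ is $W(A)=\{\langle Ax,x\rangle:\ \|x\|=1\}$; it is called elliptical if it is a (non-degenerate) elliptical disk. A reciprocal matrix is a tridiagonal matrix $A\in\mathbb C^{n\times n}$ with zero main diagonal, superdiagonal entries $b_1,\dots,b_{n-1}$ and subdiagonal entries $c_1,\dots,c_{n-1}$ satisfying $b_jc_j=1$ for all $j$. Kippenhahn curve: write $\operatorname{Re}M=(M+M^* )/2$ and $P_A(\lambda,\theta)=\det(\operatorname{Re}(e^{i\theta}A)-\lambda I)$ (the NR generating polynomial). $C(A)$ is the class-$n$ algebraic curve in $\mathbb C\cong\mathbb R^2$ whose tangent lines are $\{e^{-i\theta}(\lambda_k(\theta)+it):t\in\mathbb R\}$, $k=1,\dots,n$, $\theta\in\mathbb R$, where $\lambda_1(\theta),\dots,\lambda_n(\theta)$ are the eigenvalues of $\operatorname{Re}(e^{i\theta}A)$; $W(A)$ is the convex hull of $C(A)$. Components of $C(A)$ (with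 multiplicity) correspond to factors of $P_A$: a point $w_0\in\mathbb C$ is a component when $P_A$ is divisible by $\lambda-\operatorname{Re}(e^{i\theta}w_0)$ (so the origin corresponds to the factor $\lambda$), and an ellipse centered at $w_0$ is a component when $P_A$ is divisible by $(\lambda-\operatorname{Re}(e^{i\theta}w_0))^2-(x\cos 2\theta+y\sin 2\theta+z)$ for the corresponding $x,y,z\in\mathbb R$ with $z\ge\sqrt{x^2+y^2}$, $z>0$; when $z=\sqrt{x^2+y^2}$ the ellipse is degenerate, namely the doubleton of its foci. Here the ellipses that are components of $C(A)$ are allowed to be degenerate in this sense (the outer one, bounding $W(A)$, is non-degenerate). ''Nested'' means one lies inside the other (common points are not excluded). *)

(* Defs.v *)
(* The complex numbers are R[i] for R : realType. *)
From mathcomp Require Import all_boot all_order all_algebra.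
From mathcomp Require Import sesquilinear spectral.
From mathcomp Require Import all_classical all_reals all_analysis.
From mathcomp Require Import complex.
Set Implicit Arguments.
Unset Strict Implicit.
Unset Printing Implicit Defensive.
Import Order.TTheory GRing.Theory Num.Theory.
Import numFieldNormedType.Exports.
Local Open Scope classical_set_scope.
Local Open Scope ring_scope.
Local Open Scope complex_scope.
Local Open Scope sesquilinear_scope.

Definition cmod (R : realType) (w : R[i]) : R := Normc.normc w.

Definition expi (R : realType) (t : R) : R[i] := cos t +i* sin t.

Definition reciprocal (R : realType) (n : nat) (A : 'M[R[i]]_n) : Prop :=
  (forall i j : 'I_n, i.+1 != j -> j.+1 != i -> A i j = 0) /\
  (forall i j : 'I_n, i.+1 = j -> A i j * A j i = 1).

(* The superdiagonal entry b_j and the subdiagonal entry c_j, numbered from 1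
   as usual; meaningful only for 1 <= j <= n, where n.+1 is the size of A. *)
Definition superdiag (R : realType) (n : nat) (A : 'M[R[i]]_n.+1) (j : nat)
  : R[i] := A (inord j.-1) (inord j).

Definition subdiag (R : realType) (n : nat) (A : 'M[R[i]]_n.+1) (j : nat)
  : R[i] := A (inord j) (inord j.-1).

Definition parA (R : realType) (n : nat) (A : 'M[R[i]]_n.+1) (j : nat) : R :=
  (cmod (superdiag A j) ^+ 2 + cmod (subdiag A j) ^+ 2) / 2.

(* dotmx u v = \sum_k u 0 k * (v 0 k)^* is the inner product of row vectors;
   ||x|| = 1 is expressed as <x, x> = 1. *)
Definition numrange (R : realType) (n : nat) (A : 'M[R[i]]_n) : set R[i] :=
  [set w | exists2 x : 'cV[R[i]]_n,
     dotmx x^T x^T = 1 & w = dotmx (A *m x)^T x^T].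

Definition Remx (R : realType) (n : nat) (M : 'M[R[i]]_n) : 'M[R[i]]_n :=
  2^-1 *: (M + M ^t*).

Definition nrpoly (R : realType) (n : nat) (A : 'M[R[i]]_n) (lam t : R)
  : R[i] := \det (Remx (expi t *: A) - (lam%:C)%:M).

(* The envelope of the lines {w | Re (e^{it} w) = lambda_k(t)}.  Along a
   differentiable choice mu of an eigenvalue of Re (e^{it} A), the system
   Re (e^{it} w) = mu t, d/dt (Re (e^{it} w)) = mu' t says that the line touches
   the curve at w = e^{-it} (mu t - i mu' t).  By Rellich's theorem every
   eigenvalue lies on such a branch; constant points of C(A) are included. *)
Definition kippenhahn_curve (R : realType) (n : nat) (A : 'M[R[i]]_n)
  : set R[i] :=
  [set w | exists (mu : R -> R) (t : R),
     [/\ forall s, derivable mu s 1,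
         forall s, nrpoly A (mu s) s = 0 &
         w = expi (- t) * (mu t -i* derive1 mu t)]].

(* An ellipse is given by its foci and the constant sum of the distances of
   its points to the foci (the length of its major axis). *)
Record ellipse (R : realType) := Ellipse {
  focus1 : R[i];
  focus2 : R[i];
  major : R }.

Definition ellipse_nondegenerate (R : realType) (E : ellipse R) : Prop :=
  cmod (focus1 E - focus2 E) < major E.

(* Equality gives a degenerate ellipse; single points are excluded. *)
Definition ellipse_possibly_degenerate (R : realType) (E : ellipse R) : Prop :=
  cmod (focus1 E - focus2 E) <= major E /\ 0 < major E.

(* A degenerate ellipse consists of its two foci only. *)
Definition ellipse_curve (R : realType) (E : ellipse R) : set R[i] :=
  if cmod (focus1 E - focus2 E) == major E
  then [set focus1 E; focus2 E]
  else [set w | cmod (w - focus1 E) + cmod (w - focus2 E) = major E].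

Definition ellipse_disk (R : realType) (E : ellipse R) : set R[i] :=
  [set w | cmod (w - focus1 E) + cmod (w - focus2 E) <= major E].

Definition ellipse_center (R : realType) (E : ellipse R) : R[i] :=
  2^-1 * (focus1 E + focus2 E).

(* The foci lie on a common horizontal or vertical line (a circle, whose foci
   coincide, is axis-aligned). *)
Definition axis_aligned (R : realType) (E : ellipse R) : Prop :=
  complex.Im (focus1 E - focus2 E) = 0 \/ complex.Re (focus1 E - focus2 E) = 0.

Definition elliptical (R : realType) (W : set R[i]) : Prop :=
  exists2 E : ellipse R, ellipse_nondegenerate E & W = ellipse_disk E.

Definition point_factor (R : realType) (w0 : R[i]) (lam t : R) : R :=
  lam - complex.Re (expi t * w0).

(* With half-focal vector f = (focus1 - focus2)/2 and semi-axes a = major/2,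
   b^2 = a^2 - |f|^2, the tangent lines orthogonal to e^{-it} lie at distance
   sqrt (b^2 + Re (e^{it} f)^2) = sqrt (x cos 2t + y sin 2t + z) from the
   center, where x, y, z are as follows.  Thus z - sqrt (x^2 + y^2) = b^2, and
   the degenerate case b = 0 is z = sqrt (x^2 + y^2). *)
Definition ellipse_x (R : realType) (E : ellipse R) : R :=
  complex.Re ((2^-1 * (focus1 E - focus2 E)) ^+ 2) / 2.

Definition ellipse_y (R : realType) (E : ellipse R) : R :=
  - complex.Im ((2^-1 * (focus1 E - focus2 E)) ^+ 2) / 2.

Definition ellipse_z (R : realType) (E : ellipse R) : R :=
  (major E / 2) ^+ 2 - cmod (2^-1 * (focus1 E - focus2 E)) ^+ 2 / 2.

Definition ellipse_factor (R : realType) (E : ellipse R) (lam t : R) : R :=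
  (lam - complex.Re (expi t * ellipse_center E)) ^+ 2
  - (ellipse_x E * cos (2 * t) + ellipse_y E * sin (2 * t) + ellipse_z E).

(* Main.v *)
Require Import Defs.
From mathcomp Require Import all_boot all_order all_algebra.
From mathcomp Require Import sesquilinear spectral.
From mathcomp Require Import all_classical all_reals all_analysis.
From mathcomp Require Import complex.
From mathcomp Require Import ring lra.
Set Implicit Arguments.
Unset Strict Implicit.
Unset Printing Implicit Defensive.
Import Order.TTheory GRing.Theory Num.Theory.
Import numFieldNormedType.Exports.
Import ComplexField.Normc.
Local Open Scope classical_set_scope.
Local Open Scope ring_scope.
Local Open Scope complex_scope.
Local Open Scope sesquilinear_scope.

(** The real part of e^{it} A is a Hermitian tridiagonal matrix with zero
    diagonal, and the products of its symmetric off-diagonal entries are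
    p_j = (A_j + cos 2t) / 2.  Hence det (Re (e^{it} A) - l) is
      - l (l^4 - S l^2 + T),  S = p_1 + p_2 + p_3 + p_4,
                              T = p_1 p_3 + p_1 p_4 + p_2 p_4,
    which depends on t through c = cos 2t only ([nrpoly_reciprocal]).  Its
    biquadratic factor has the discriminant
      S^2 - 4 T = (c + (A_2 + A_3) / 2)^2 + D / 4,
      D = (A_1 - A_4) (A_1 - A_4 - 2 (A_3 - A_2))      ([discriminantE]),
    so the condition on the A_j is that D vanishes, that is, that the
    discriminant is a square in c.

    The link with the numerical range is its support function: the largest
    value of Re (e^{it} w) over W(A) is the largest root of the polynomial
    ([numrange_support], from the spectral theorem).

    If W(A) is an elliptical disk, its squared support function is, after the
    center is shown to be 0, of the form x cos 2t + y sin 2t + z.  Equating it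
    with (S + sqrt (S^2 - 4 T)) / 2, which is even in t, kills y and makes
    sqrt (S^2 - 4 T) affine in c.  Comparing coefficients gives D = 0
    ([elliptical_split]).  If all A_j were 1, the support function would vanish
    at t = pi/2, where that of a non-degenerate ellipse does not
    ([elliptical_nontrivial]).

    Conversely, D = 0 splits the biquadratic factor into l^2 - w_out and
    l^2 - w_in, where w_out = 3/2 c + (A_1 + A_4)/4 + (A_2 + A_3)/2 and
    w_in = c/2 + (A_1 + A_4)/4 are the squared support functions of ellipses
    with foci +-sqrt 3 and +-1 ([nrpoly_split]).  W(A) is convex (the
    Toeplitz-Hausdorff theorem, [numrange_convex]) and has the support
    function of the outer disk.  The support is attained in W(A), and a line
    supporting a non-degenerate disk meets it in one point, so W(A) contains
    the boundary of the disk, hence the disk ([convex_ellipse_disk]).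

    For the Kippenhahn curve, each component has an everywhere differentiable
    eigenvalue branch: +-sqrt w for a non-degenerate ellipse, and
    +-Re (e^{it} f) for the doubleton {f, -f}.  An arbitrary differentiable
    branch may change from one of these to another at a crossing, but at every
    t it shares both value and derivative with one of them
    ([derivable_select]), so it yields no further points
    ([kippenhahn_two_ellipses]). *)

(** * Numerical ranges of general matrices *)

Lemma dotmx_quadE (C : numClosedFieldType) (n : nat) (M : 'M[C]_n)
    (x y : 'cV[C]_n) :
  dotmx (M *m x)^T y^T = (y^t* *m M *m x) 0 0.
Proof.
rewrite dotmxE -mulmxA.
have -> : y^t* *m (M *m x) = ((M *m x)^T *m y^T ^t*)^T.
  by rewrite trmx_mul !trmxK map_trmx.
by rewrite [in RHS]mxE.
Qed.

(** In a unitary eigenbasis the quadratic form is the sum of the eigenvalues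
    weighted by squared moduli of coordinates, and the eigenvalues are real
    roots of the characteristic determinant. *)
Lemma hermitian_quad_le (R : realType) (n : nat) (H : 'M[R[i]]_n) (L : R) :
  H^t* = H ->
  (forall l : R, \det (H - (l%:C)%:M) = 0 -> l <= L) ->
  forall x : 'cV[R[i]]_n,
    dotmx (H *m x)^T x^T <= L%:C * dotmx x^T x^T.
Proof.
move=> Hherm HL x.
have Hh : H \is hermsymmx.
  by apply/is_hermitianmxP; rewrite expr0 scale1r Hherm.
have /orthomx_spectralP HE := hermitian_normalmx Hh.
set P := spectralmx H in HE; set D := spectral_diag H in HE.
have PU : P \is unitarymx by exact: spectral_unitarymx.
have Punit : P \in unitmx by exact: spectral_unit.
have Dle i : D 0 i <= L%:C.
  have /mxOverP/(_ 0 i) Dreal := hermitian_spectral_diag_real Hh.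
  rewrite -(RRe_real Dreal) lecR; apply: HL; rewrite (RRe_real Dreal).
  have -> : H - (D 0 i)%:M = invmx P *m (diag_mx D - (D 0 i)%:M) *m P.
    rewrite mulmxBr mulmxBl -HE; congr (_ - _).
    by rewrite mul_mx_scalar -scalemxAl mulVmx // scalemx1.
  rewrite !det_mulmx -[(D 0 i)%:M]diag_const_mx -raddfB /= det_diag.
  by rewrite (bigD1 i) //= !mxE subrr mul0r mulr0 mul0r.
pose y := P *m x.
have yE : y^t* = x^t* *m invmx P.
  by rewrite /y trmx_mul map_mxM invmx_unitary.
have -> : dotmx (H *m x)^T x^T = \sum_i D 0 i * (y i 0 * (y i 0)^*%R).
  rewrite dotmx_quadE {1}HE !mulmxA -yE -mulmxA -/y mxE.
  by apply: eq_bigr => i _; rewrite mul_mx_diag !mxE; ring.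
have -> : dotmx x^T x^T = \sum_i y i 0 * (y i 0)^*%R.
  rewrite -{1}(mul1mx x) dotmx_quadE.
  rewrite -(mulVmx Punit) mulmxA -yE -mulmxA -/y mxE.
  by apply: eq_bigr => i _; rewrite !mxE mulrC.
rewrite mulr_sumr; apply: ler_sum => i _.
by apply: ler_wpM2r => //; rewrite mul_conjC_ge0.
Qed.

Lemma Remx_herm (R : realType) (n : nat) (M : 'M[R[i]]_n) :
  (Remx M)^t* = Remx M.
Proof.
apply/matrixP => i j; rewrite !mxE rmorphM rmorphD /= conjCK addrC.
by congr (_ * _); rewrite fmorphV rmorph_nat.
Qed.

Lemma dotmx_Remx (R : realType) (n : nat) (M : 'M[R[i]]_n) (x : 'cV[R[i]]_n) :
  dotmx (Remx M *m x)^T x^T = (complex.Re (dotmx (M *m x)^T x^T))%:C.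
Proof.
rewrite ReJ_add /Remx -scalemxAl mulmxDl linearZ /= linearZl_LR /=.
rewrite raddfD linearDl /= mulrC; congr ((_ + _) / _).
rewrite dotmx_quadE; have := dotmx_quadE M x x.
move=> ->; have -> : forall w : R[i], w^*%C = (w^*)%R by [].
transitivity (((x^t* *m M *m x)^t*) 0 0); last by rewrite !mxE.
by rewrite !trmx_mul !map_mxM /= trmxCK mulmxA.
Qed.

Lemma numrange_Re (R : realType) (n : nat) (A : 'M[R[i]]_n) (t : R)
    (x : 'cV[R[i]]_n) :
  dotmx (Remx (expi t *: A) *m x)^T x^T
  = (complex.Re (expi t * dotmx (A *m x)^T x^T))%:C.
Proof.
by rewrite dotmx_Remx -scalemxAl linearZ /= linearZl_LR.
Qed.

Lemma numrange_Re_le (R : realType) (n : nat) (A : 'M[R[i]]_n) (t L : R) :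
  (forall l, nrpoly A l t = 0 -> l <= L) ->
  forall w, numrange A w -> complex.Re (expi t * w) <= L.
Proof.
move=> HL w [x x1 ->]; rewrite -lecR -numrange_Re.
by have := hermitian_quad_le (Remx_herm (expi t *: A)) HL x; rewrite x1 mulr1.
Qed.

(** The normalizing scalar is given together with its squared modulus, which is
    the factor by which quadratic forms of the vector get multiplied. *)
Lemma exists_normalize (C : numClosedFieldType) (n : nat) (x : 'cV[C]_n) :
  x != 0 ->
  exists2 c : C, dotmx (c *: x)^T (c *: x)^T = 1 & c * c^* = (dotmx x^T x^T)^-1.
Proof.
move=> x0; set N := dotmx x^T x^T.
have N0 : 0 < N by rewrite dnorm_gt0 -trmx0 (inj_eq trmx_inj).
have cc : (sqrtC N)^-1 * ((sqrtC N)^-1)^* = N^-1.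
  rewrite geC0_conj ?invr_ge0 ?sqrtC_ge0 ?ltW //.
  by rewrite -expr2 exprVn sqrtCK.
exists (sqrtC N)^-1; last exact: cc.
rewrite linearZ /= linearZl_LR linearZr /= mulrA cc mulVf //.
by rewrite gt_eqF.
Qed.

Lemma numrange_normalize (R : realType) (n : nat) (A : 'M[R[i]]_n)
    (x : 'cV[R[i]]_n) :
  x != 0 ->
  numrange A (dotmx (A *m x)^T x^T / dotmx x^T x^T).
Proof.
move=> /exists_normalize[c c1 cc]; exists (c *: x) => //.
rewrite -scalemxAr !linearZ /= linearZl_LR linearZr /= mulrA cc mulrC.
by [].
Qed.

Lemma numrange_eigen (R : realType) (n : nat) (A : 'M[R[i]]_n) (t L : R) :
  nrpoly A L t = 0 ->
  exists2 w, numrange A w & complex.Re (expi t * w) = L.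
Proof.
rewrite /nrpoly; set H := Remx (expi t *: A) => Hdet.
have : \det (H - (L%:C)%:M)^T == 0 by rewrite det_tr; apply/eqP.
case/det0P => v v0 vH.
have Hv : H *m v^T = L%:C *: v^T.
  apply/eqP; rewrite -subr_eq0 -mul_scalar_mx -mulmxBl.
  by rewrite -[_ *m _]trmxK trmx_mul trmxK vH trmx0.
have /exists_normalize[c x1 _] : v^T != 0 by rewrite -trmx0 (inj_eq trmx_inj).
exists (dotmx (A *m (c *: v^T))^T (c *: v^T)^T); first by exists (c *: v^T).
apply: complexI; rewrite -numrange_Re -/H -scalemxAr Hv scalerA mulrC -scalerA.
by rewrite linearZ /= linearZl_LR /= x1 mulr1.
Qed.

(** With d = p - q^*, the imaginary part of e^* p + e q is that of e^* d; it
    vanishes for e = d / |d|. *)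
Lemma exists_phase (C : numClosedFieldType) (p q : C) :
  exists2 e : C, e * Num.conj e = 1 & Num.conj e * p + e * q \is Num.real.
Proof.
pose d := p - Num.conj q.
have [d0|d0] := eqVneq d 0.
  exists 1; first by rewrite conjC1 mulr1.
  rewrite conjC1 !mul1r CrealE rmorphD /=.
  have -> : p = Num.conj q by apply/eqP; rewrite -subr_eq0 -/d d0.
  by rewrite conjCK addrC.
have n0 : `|d| != 0 by rewrite normr_eq0.
have nc : Num.conj (`|d|^-1) = `|d|^-1 by rewrite geC0_conj // invr_ge0.
exists (d / `|d|).
  by rewrite rmorphM /= nc mulrACA -normCK -expr2 exprVn mulfV // expf_neq0.
have -> : p = d + Num.conj q by rewrite /d subrK.
clearbody d; rewrite CrealE -subr_eq0 !(rmorphM, rmorphD) /= !conjCK !nc.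
by apply/eqP; ring.
Qed.

Lemma quadratic_root (R : rcfType) (a b c : R) : 0 < a -> 0 < c ->
  exists v, a * v ^+ 2 + b * v = c.
Proof.
move=> a0 c0; pose v := (- b + Num.sqrt (b ^+ 2 + 4 * a * c)) / (2 * a).
exists v.
have := sqr_sqrtr (_ : 0 <= b ^+ 2 + 4 * a * c).
rewrite /v; set s := Num.sqrt _ => sE.
have {}sE : s ^+ 2 = b ^+ 2 + 4 * a * c.
  by apply: sE; rewrite addr_ge0 ?sqr_ge0 // !mulr_ge0 // ltW.
have -> : c = (s ^+ 2 - b ^+ 2) / (4 * a).
  by rewrite sE; field; rewrite gt_eqF.
by field; rewrite gt_eqF.
Qed.

Lemma dotmx_pencil (C : numClosedFieldType) (n : nat) (M : 'M[C]_n)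
    (x y : 'cV[C]_n) (c : C) :
  dotmx (M *m (x + c *: y))^T (x + c *: y)^T
  = dotmx (M *m x)^T x^T + Num.conj c * dotmx (M *m x)^T y^T
    + c * dotmx (M *m y)^T x^T + c * Num.conj c * dotmx (M *m y)^T y^T.
Proof.
set rhs := RHS.
rewrite mulmxDr -scalemxAr !linearD !linearZ /= linearDl !linearDr /=.
by rewrite !linearZl_LR !linearZr /= /rhs !addrA !mulrA.
Qed.

Lemma dotmx_scale (C : numClosedFieldType) (n : nat) (M : 'M[C]_n)
    (x : 'cV[C]_n) (c : C) :
  dotmx (M *m (c *: x))^T (c *: x)^T
  = c * Num.conj c * dotmx (M *m x)^T x^T.
Proof.
by rewrite -scalemxAr !linearZ /= linearZl_LR linearZr /= mulrA.
Qed.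

(** The computation behind convexity: with [f] the conjugate of [e], [rho] and
    [sig] the two inner products of x and y, and [p], [q] the cross terms of A,
    the equation for [v] says that the Rayleigh quotient of A at x + v e y
    is the point w1 + s dl of the segment. *)
Lemma toeplitz_algebra (F : fieldType) (w1 dl p q e f rho sig v r g s : F) :
  dl != 0 -> e * f = 1 ->
  f * ((p - w1 * rho) / dl) + e * ((q - w1 * sig) / dl) = r ->
  f * rho + e * sig = g ->
  (1 - s) * v ^+ 2 + (r - s * g) * v = s ->
  w1 + v * f * p + v * e * q + v * e * (v * f) * (w1 + dl)
  = (w1 + s * dl) * (1 + v * f * rho + v * e * sig + v * e * (v * f)).
Proof.
move=> dl0 ef rE gE vE; apply/eqP; rewrite -subr_eq0; apply/eqP.
have pq : f * p + e * q = dl * r + w1 * g by rewrite -rE -gE; field.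
transitivity (dl * ((1 - s) * v ^+ 2 + (r - s * g) * v - s)); last first.
  by rewrite vE subrr mulr0.
transitivity (w1 + v * (f * p + e * q) + v ^+ 2 * (e * f) * (w1 + dl)
  - (w1 + s * dl) * (1 + v * (f * rho + e * sig) + v ^+ 2 * (e * f))).
  by ring.
by rewrite pq gE ef; ring.
Qed.

(** Toeplitz-Hausdorff.  Write the end points as Rayleigh quotients at x and y.
    The phase e turns the cross terms, normalized so that the end points
    become 0 and 1, into a real number; then the Rayleigh quotient at
    x + v e y, for real v, runs over real numbers, and it equals s when v
    solves a quadratic equation whose constant term and leading coefficient
    have opposite signs. *)
Lemma numrange_convex (R : realType) (n : nat) (A : 'M[R[i]]_n) (w1 w2 : R[i])
    (s : R) :
  numrange A w1 -> numrange A w2 -> 0 <= s <= 1 ->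
  numrange A (w1 + s%:C * (w2 - w1)).
Proof.
move=> W1 W2 /andP[s0 s1].
have [->|w12] := eqVneq w2 w1; first by rewrite subrr mulr0 addr0.
move: s0; rewrite le_eqVlt => /predU1P[<-|s0]; first by rewrite mul0r addr0.
move: s1; rewrite le_eqVlt => /predU1P[->|s1].
  by rewrite mul1r addrC subrK.
case: W1 => x x1 w1E; case: W2 => y y1 w2E.
have dl0 : w2 - w1 != 0 by rewrite subr_eq0.
set dl := w2 - w1 in dl0 *.
set rho := dotmx x^T y^T.
have rhoc : dotmx y^T x^T = Num.conj rho.
  by rewrite (hermC (dotmx (n:=n))) expr0 mul1r.
set p := dotmx (A *m x)^T y^T; set q := dotmx (A *m y)^T x^T.
have [e ee1 /complex_realP[r rE]] :=
  exists_phase ((p - w1 * rho) / dl) ((q - w1 * Num.conj rho) / dl).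
have /complex_realP[g gE] : Num.conj e * rho + e * Num.conj rho \is Num.real.
  by rewrite CrealE rmorphD !rmorphM /= !conjCK addrC.
have [v vE] : exists v, (1 - s) * v ^+ 2 + (r - s * g) * v = s.
  by apply: quadratic_root => //; rewrite subr_gt0.
have vE' : (1 - s%:C) * v%:C ^+ 2 + (r%:C - s%:C * g%:C) * v%:C = s%:C.
  by rewrite -[in RHS]vE rmorphD !rmorphM /= !rmorphB /= rmorphM /= -expr2.
pose c := v%:C * e.
have cE : Num.conj c = v%:C * Num.conj e.
  by rewrite /c rmorphM /=; congr (_ * _); rewrite /Num.conj /= oppr0.
pose z := x + c *: y.
have key : dotmx (A *m z)^T z^T = (w1 + s%:C * dl) * dotmx z^T z^T.
  have -> : dotmx z^T z^T = dotmx (1%:M *m z)^T z^T by rewrite mul1mx.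
  rewrite !dotmx_pencil.
  rewrite !mul1mx x1 y1 mulr1 rhoc -w1E -w2E -/p -/q -/rho cE /c.
  rewrite [w2](_ : _ = w1 + dl); last by rewrite /dl addrC subrK.
  exact: (toeplitz_algebra dl0 ee1 rE gE vE').
(* If z = 0, then x is a multiple of y, and the end points coincide. *)
have z0 : z != 0.
  apply/eqP => z0; have xE : x = (- c) *: y.
    by apply/eqP; rewrite -subr_eq0 scaleNr opprK -/z z0.
  have cc1 : - c * Num.conj (- c) = 1.
    have := dotmx_scale 1%:M y (- c).
    by rewrite -xE !mul1mx x1 y1 mulr1 => <-.
  by move: w12; rewrite w1E xE dotmx_scale cc1 mul1r -w2E eqxx.
have := numrange_normalize A z0; rewrite key mulfK // dnorm_eq0.
by rewrite -trmx0 (inj_eq trmx_inj).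
Qed.

(** * Determinants of tridiagonal matrices *)

Definition tridiag (K : pzRingType) (a b c : nat -> K) (n : nat) : 'M[K]_n :=
  \matrix_(i, j) (if i == j :> nat then a i else
                  if j == i.+1 :> nat then b i else
                  if i == j.+1 :> nat then c j else 0).

(** The three-term recurrence of continuants: expand along the first row, then
    expand the second minor along its first column. *)
Lemma det_tridiag (K : comPzRingType) (a b c : nat -> K) (n : nat) :
  \det (tridiag a b c n.+2)
  = a 0 * \det (tridiag (a \o S) (b \o S) (c \o S) n.+1)
    - b 0 * c 0 * \det (tridiag (a \o S \o S) (b \o S \o S) (c \o S \o S) n).
Proof.
rewrite (expand_det_row _ ord0) 2!big_ord_recl big1 => [|j _]; last first.
  by rewrite !mxE /= mul0r.
rewrite addr0 -mulrA -mulrN !mxE /=; congr (_ * _ + _ * _).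
  rewrite /cofactor /= expr0 mul1r; congr (\det _).
  by apply/matrixP => i j; rewrite !mxE /=.
rewrite /cofactor /= expr1 mulN1r; congr (- _).
rewrite (expand_det_col _ ord0) big_ord_recl big1 => [|j _]; last first.
  by rewrite !mxE /= mul0r.
rewrite addr0 !mxE /=; congr (_ * _).
rewrite /cofactor /= expr0 mul1r; congr (\det _).
by apply/matrixP => i j; rewrite !mxE /=.
Qed.

Lemma det_tridiag5 (K : comPzRingType) (l : K) (b c : nat -> K) :
  \det (tridiag (fun=> - l) b c 5)
  = - (l * (l ^+ 4
     - (b 0 * c 0 + b 1 * c 1 + b 2 * c 2 + b 3 * c 3) * l ^+ 2
     + (b 0 * c 0 * (b 2 * c 2) + b 0 * c 0 * (b 3 * c 3) + b 1 * c 1 * (b 3 * c 3)))).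
Proof.
rewrite !det_tridiag !det_mx00 !det_mx11 !mxE /=.
ring.
Qed.

(** * The generating polynomial of a reciprocal matrix *)

(** Product of the symmetric off-diagonal entries number [j] of
    Re (e^{it} A). *)
Definition offdiag (R : realType) (A : 'M[R[i]]_5) (t : R) (j : nat) : R :=
  (parA A j + cos (2 * t)) / 2.

Lemma recip_pair_algebra (F : numFieldType) (e e' b b' c c' : F) :
  e * e' = 1 -> b * c = 1 -> b' * c' = 1 ->
  2^-1 * (e * b + e' * c') * (2^-1 * (e * c + e' * b'))
  = ((b * b' + c * c') / 2 + (e ^+ 2 + e' ^+ 2) / 2) / 2.
Proof.
move=> ee bc bc'.
transitivity ((e ^+ 2 * (b * c) + (e * e') * (b * b' + c * c')
               + e' ^+ 2 * (b' * c')) / 4); first by field.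
by rewrite bc bc' ee; field.
Qed.

(** The product of the symmetric entries in positions (j, j+1) and (j+1, j) of
    Re (e^{it} A): since b c = 1, its dependence on the phases of b and c
    disappears. *)
Lemma recip_pair (R : realType) (b c : R[i]) (t : R) : b * c = 1 ->
  (2^-1 * (expi t * b + Num.conj (expi t * c)))
  * (2^-1 * (expi t * c + Num.conj (expi t * b)))
  = (((cmod b ^+ 2 + cmod c ^+ 2) / 2 + cos (2 * t)) / 2)%:C.
Proof.
move=> bc.
have nE (z : R[i]) : (cmod z ^+ 2)%:C = z * Num.conj z.
  by rewrite -normCK rmorphXn.
have ee : expi t * Num.conj (expi t) = 1.
  rewrite /expi /Num.conj /=; apply/eqP; rewrite eq_complex /=; apply/andP.
  split; apply/eqP; last by ring.
  by rewrite -[RHS](cos2Dsin2 t); ring.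
have eE : (cos (2 * t))%:C = (expi t ^+ 2 + Num.conj (expi t) ^+ 2) / 2.
  apply: (mulIf (_ : 2 != 0)); first by rewrite pnatr_eq0.
  rewrite mulfVK ?pnatr_eq0 // mulr_natr -rmorphMn /=.
  rewrite mulr_natl cos_mulr2n -(cos2Dsin2 t).
  rewrite /Num.conj /= /expi; apply/eqP; rewrite eq_complex /=; apply/andP.
  by split; apply/eqP; ring.
rewrite !rmorphM /= !rmorphD /= !rmorphM /= rmorphD /= !nE.
rewrite fmorphV /= rmorph_nat eE.
have bc' : Num.conj b * Num.conj c = 1 by rewrite -rmorphM bc rmorph1.
exact: recip_pair_algebra.
Qed.

Lemma Remx_tridiag (R : realType) (A : 'M[R[i]]_5) (l t : R) :
  reciprocal A ->
  Remx (expi t *: A) - (l%:C)%:M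
  = tridiag (fun=> - l%:C)
      (fun j => 2^-1 * (expi t * superdiag A j.+1
                        + Num.conj (expi t * subdiag A j.+1)))
      (fun j => 2^-1 * (expi t * subdiag A j.+1
                        + Num.conj (expi t * superdiag A j.+1))) 5.
Proof.
case=> Aband _; apply/matrixP => i j; rewrite !mxE.
rewrite /superdiag /subdiag /=.
case: ifPn => [/eqP/val_inj->|ij].
  rewrite eqxx mulr1n Aband ?gtn_eqF //.
  by rewrite mulr0 rmorph0 addr0 mulr0 add0r.
rewrite -(inj_eq val_inj) (negPf ij) mulr0n subr0.
case: ifPn => [/eqP ji|ji]; first by rewrite -ji !inord_val.
case: ifPn => [/eqP ji'|ji']; first by rewrite -ji' !inord_val.
rewrite !Aband 1?eq_sym // !mulr0 rmorph0 addr0 mulr0 //.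
Qed.

Definition edge_sum (R : realType) (A : 'M[R[i]]_5) (t : R) : R :=
  offdiag A t 1 + offdiag A t 2 + offdiag A t 3 + offdiag A t 4.

(** Sum over the pairs of disjoint edges of the path 1 - 2 - 3 - 4 - 5. *)
Definition matching_sum (R : realType) (A : 'M[R[i]]_5) (t : R) : R :=
  offdiag A t 1 * offdiag A t 3 + offdiag A t 1 * offdiag A t 4
  + offdiag A t 2 * offdiag A t 4.

Lemma nrpoly_reciprocal (R : realType) (A : 'M[R[i]]_5) (l t : R) :
  reciprocal A ->
  nrpoly A l t = (- (l * (l ^+ 4 - edge_sum A t * l ^+ 2 + matching_sum A t)))%:C.
Proof.
move=> Arec; rewrite /nrpoly Remx_tridiag // det_tridiag5.
have pE (j : nat) : (j < 4)%N ->
  2^-1 * (expi t * superdiag A j.+1 + Num.conj (expi t * subdiag A j.+1))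
  * (2^-1 * (expi t * subdiag A j.+1 + Num.conj (expi t * superdiag A j.+1)))
  = (offdiag A t j.+1)%:C.
  move=> j4; apply: recip_pair; apply: Arec.2.
  by rewrite !inordK //= (leq_trans j4).
by rewrite !pE // /edge_sum /matching_sum
  !(rmorphN, rmorphB, rmorphD, rmorphM, rmorphXn).
Qed.

Lemma parA_ge1 (R : realType) (A : 'M[R[i]]_5) (j : nat) :
  reciprocal A -> (1 <= j <= 4)%N -> 1 <= parA A j.
Proof.
move=> Arec /andP[j1 j4].
have bc : superdiag A j * subdiag A j = 1.
  apply: Arec.2; rewrite !inordK ?prednK //.
  exact: ltnW.
have : cmod (superdiag A j) * cmod (subdiag A j) = 1.
  by rewrite /cmod -normcM bc normc1.
rewrite /parA; set x := cmod _; set y := cmod _ => xy.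
have := sqr_ge0 (x - y); lra.
Qed.

(** * Support functions of ellipses *)

Lemma cmodE (R : realType) (w : R[i]) :
  cmod w = Num.sqrt (complex.Re w ^+ 2 + complex.Im w ^+ 2).
Proof. by case: w. Qed.

Lemma sqr_cmod (R : realType) (w : R[i]) :
  cmod w ^+ 2 = complex.Re w ^+ 2 + complex.Im w ^+ 2.
Proof. by rewrite cmodE sqr_sqrtr // addr_ge0 ?sqr_ge0. Qed.

Lemma cmod_ge0 (R : realType) (w : R[i]) : 0 <= cmod w.
Proof. by rewrite cmodE sqrtr_ge0. Qed.

Lemma Re_expi (R : realType) (t : R) (w : R[i]) :
  complex.Re (expi t * w) = cos t * complex.Re w - sin t * complex.Im w.
Proof. by case: w. Qed.

Lemma ReD (R : realType) (z w : R[i]) :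
  complex.Re (z + w) = complex.Re z + complex.Re w.
Proof. by case: z w => [? ?] [? ?]. Qed.

Lemma ReN (R : realType) (z : R[i]) : complex.Re (- z) = - complex.Re z.
Proof. by case: z. Qed.

Lemma ImN (R : realType) (z : R[i]) : complex.Im (- z) = - complex.Im z.
Proof. by case: z. Qed.

Lemma ImD (R : realType) (z w : R[i]) :
  complex.Im (z + w) = complex.Im z + complex.Im w.
Proof. by case: z w => [? ?] [? ?]. Qed.

Lemma exists_angle (R : realType) (x y : R) :
  x ^+ 2 + y ^+ 2 = 1 -> exists t, cos t = x /\ sin t = y.
Proof.
move=> xy1.
have x1 : -1 <= x <= 1 by have := sqr_ge0 y => y2; apply/andP; split; nra.
have sx : Num.sqrt (1 - x ^+ 2) = `|y|.
  by rewrite -xy1 addrC addKr sqrtr_sqr.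
have cx : cos (acos x) = x by apply: acosK; rewrite in_itv.
have [y0|y0] := leP 0 y.
  by exists (acos x); rewrite sin_acos // sx ger0_norm.
by exists (- acos x); rewrite cosN sinN sin_acos // sx ltr0_norm // opprK.
Qed.

Lemma cos2E (R : realType) (t : R) : cos (2 * t) = cos t ^+ 2 - sin t ^+ 2.
Proof. by rewrite mulr_natl cos_mulr2n -(cos2Dsin2 t); ring. Qed.

Lemma sin2E (R : realType) (t : R) : sin (2 * t) = 2 * cos t * sin t.
Proof. by rewrite mulr_natl sin_mulr2n; ring. Qed.

Section EllipseReal.
Variables (R : rcfType) (a fx fy : R).
Hypothesis a0 : 0 < a.
Hypothesis fa : fx ^+ 2 + fy ^+ 2 < a ^+ 2.
Let B := a ^+ 2 - (fx ^+ 2 + fy ^+ 2).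
Let Q x y := a ^+ 2 * (x ^+ 2 + y ^+ 2) - (fx * x + fy * y) ^+ 2.

(** With d1, d2 the distances of (x, y) to the foci and
    m = 2 a^2 - |p|^2 - |f|^2, the sum condition is d1 d2 <= m, while
    (d1 d2)^2 - m^2 is four times the difference of the two quadratic
    expressions; positivity of m on the disk follows from Cauchy-Schwarz. *)
Lemma sum_dist_le (x y : R) :
  (Num.sqrt ((x - fx) ^+ 2 + (y - fy) ^+ 2)
   + Num.sqrt ((x + fx) ^+ 2 + (y + fy) ^+ 2) <= 2 * a <->
   Q x y <= a ^+ 2 * B) /\
  (Num.sqrt ((x - fx) ^+ 2 + (y - fy) ^+ 2)
   + Num.sqrt ((x + fx) ^+ 2 + (y + fy) ^+ 2) = 2 * a <->
   Q x y = a ^+ 2 * B).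
Proof.
set d1 := Num.sqrt _; set d2 := Num.sqrt _.
have d10 : 0 <= d1 by exact: sqrtr_ge0.
have d20 : 0 <= d2 by exact: sqrtr_ge0.
have d1E : d1 ^+ 2 = (x - fx) ^+ 2 + (y - fy) ^+ 2.
  by rewrite sqr_sqrtr // addr_ge0 ?sqr_ge0.
have d2E : d2 ^+ 2 = (x + fx) ^+ 2 + (y + fy) ^+ 2.
  by rewrite sqr_sqrtr // addr_ge0 ?sqr_ge0.
clearbody d1 d2.
pose m := 2 * a ^+ 2 - (x ^+ 2 + y ^+ 2) - (fx ^+ 2 + fy ^+ 2).
have dm : (d1 * d2) ^+ 2 - m ^+ 2 = 4 * (Q x y - a ^+ 2 * B).
  by rewrite exprMn d1E d2E /m /Q /B; ring.
have sm : (d1 + d2) ^+ 2 - (2 * a) ^+ 2 = 2 * (d1 * d2 - m).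
  transitivity (d1 ^+ 2 + d2 ^+ 2 + 2 * (d1 * d2) - 4 * a ^+ 2); first by ring.
  by rewrite d1E d2E /m; ring.
have m0 : Q x y <= a ^+ 2 * B -> 0 <= m.
  rewrite /Q /B => QB; rewrite /m.
  have cs := sqr_ge0 (fx * y - fy * x).
  have : (x ^+ 2 + y ^+ 2) * B <= a ^+ 2 * B.
    have -> : (x ^+ 2 + y ^+ 2) * B
              = a ^+ 2 * (x ^+ 2 + y ^+ 2) - (fx * x + fy * y) ^+ 2
                - (fx * y - fy * x) ^+ 2 by rewrite /B; ring.
    by apply: le_trans QB; rewrite gerBl.
  rewrite ler_pM2r; last by rewrite /B subr_gt0.
  by move: fa; lra.
have dd0 : 0 <= d1 * d2 by exact: mulr_ge0.
have ad0 : 0 <= 2 * a by rewrite mulr_ge0 // ltW.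
have le1 : (d1 + d2 <= 2 * a) = (d1 * d2 <= m).
  rewrite -[LHS](ler_pXn2r (n:=2)) ?nnegrE ?addr_ge0 // -[LHS]subr_le0 sm.
  by rewrite pmulr_rle0 // subr_le0.
have eq1 : (d1 + d2 == 2 * a) = (d1 * d2 == m).
  rewrite -[LHS](eqrXn2 (n:=2)) ?addr_ge0 // -[LHS]subr_eq0 sm.
  by rewrite mulf_eq0 pnatr_eq0 /= subr_eq0.
split.
  rewrite le1; split=> [dml|QB].
    have m0' : 0 <= m by exact: le_trans dml.
    rewrite -subr_le0 -(pmulr_rle0 _ (_ : 0 < 4)) // -dm subr_le0.
    by rewrite ler_pXn2r.
  have m0' := m0 QB.
  by rewrite -(ler_pXn2r (n:=2)) ?nnegrE // -subr_le0 dm pmulr_rle0 // subr_le0.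
split=> [/eqP|QB].
  rewrite eq1 => /eqP dmE; move: dm; rewrite dmE subrr => /esym/eqP.
  by rewrite mulf_eq0 pnatr_eq0 /= subr_eq0 => /eqP.
have m0' : 0 <= m by apply: m0; rewrite QB.
apply/eqP; rewrite eq1 -(eqrXn2 (n:=2)) // -subr_eq0 dm QB subrr mulr0 //.
Qed.

(** Lagrange-type identity for the matrix M = a^2 I - f f^T of the quadratic
    form and the matrix B I + f f^T of the dual form, which is also the form of
    M on vectors turned by a right angle. *)
Lemma quad_dual (x y u v : R) :
  Q x y * (B * (u ^+ 2 + v ^+ 2) + (fx * u + fy * v) ^+ 2)
  - a ^+ 2 * B * (x * u + y * v) ^+ 2
  = (a ^+ 2 * (y * u - x * v) - (fx * x + fy * y) * (fy * u - fx * v)) ^+ 2.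
Proof. by rewrite /Q /B; ring. Qed.

End EllipseReal.

Section Ellipse.
Variables (R : realType) (E : ellipse R).

Definition half_focal : R[i] := 2^-1 * (focus1 E - focus2 E).

(** The square of the minor semi-axis. *)
Definition minor_sq : R := (major E / 2) ^+ 2 - cmod half_focal ^+ 2.

(** The square of the support function relative to the center. *)
Definition width_sq (t : R) : R :=
  ellipse_x E * cos (2 * t) + ellipse_y E * sin (2 * t) + ellipse_z E.

Definition ellipse_support (t : R) : R :=
  complex.Re (expi t * ellipse_center E) + Num.sqrt (width_sq t).

Lemma width_sqE (t : R) :
  width_sq t = minor_sq + complex.Re (expi t * half_focal) ^+ 2.
Proof.
rewrite /width_sq /minor_sq Re_expi /ellipse_x /ellipse_y /ellipse_z.
rewrite -/half_focal; case: half_focal => x y; rewrite sqr_cmod /= cos2E sin2E.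
have := cos2Dsin2 t; set c := cos t; set s := sin t => cs.
transitivity ((major E / 2) ^+ 2 - (x ^+ 2 + y ^+ 2) * (c ^+ 2 + s ^+ 2)
  + (c * x - s * y) ^+ 2 + (x ^+ 2 + y ^+ 2) / 2 * (c ^+ 2 + s ^+ 2 - 1)).
  by field.
by rewrite cs; field.
Qed.

Lemma focus1E : focus1 E = ellipse_center E + half_focal.
Proof. by rewrite /ellipse_center /half_focal; field. Qed.

Lemma focus2E : focus2 E = ellipse_center E - half_focal.
Proof. by rewrite /ellipse_center /half_focal; field. Qed.

Lemma cmod_focal : cmod (focus1 E - focus2 E) = 2 * cmod half_focal.
Proof.
have -> : focus1 E - focus2 E = (2 : R)%:C * half_focal.
  by rewrite rmorph_nat /half_focal mulrA mulfV ?mul1r // pnatr_eq0.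
rewrite /cmod normcM; congr (_ * _).
by rewrite /= expr0n addr0 sqrtr_sqr ger0_norm.
Qed.

(** Equation of the ellipse without square roots: the boundary is the level
    (major / 2)^2 * minor_sq of this positive definite form. *)
Definition ellipse_quad (w : R[i]) : R :=
  let p := w - ellipse_center E in
  (major E / 2) ^+ 2 * (complex.Re p ^+ 2 + complex.Im p ^+ 2)
  - (complex.Re half_focal * complex.Re p
     + complex.Im half_focal * complex.Im p) ^+ 2.

(** Point where the supporting line with normal u = e^{-it} touches: the dual
    form applied to u, divided by the support function. *)
Definition touch (t : R) : R[i] :=
  let g := complex.Re (expi t * half_focal) in
  let h := Num.sqrt (width_sq t) in
  ellipse_center E
  + (((minor_sq * cos t + g * complex.Re half_focal) / h)
     +i* ((g * complex.Im half_focal - minor_sq * sin t) / h)).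

Hypothesis ndE : ellipse_nondegenerate E.

Let a0 : 0 < major E / 2.
Proof.
rewrite divr_gt0 //; apply: le_lt_trans ndE; exact: cmod_ge0.
Qed.

Let fa : complex.Re half_focal ^+ 2 + complex.Im half_focal ^+ 2
         < (major E / 2) ^+ 2.
Proof.
rewrite -sqr_cmod ltr_pXn2r ?nnegrE ?cmod_ge0 // ?ltW //.
by rewrite ltr_pdivlMr // mulrC -cmod_focal.
Qed.

Lemma minor_sq_gt0 : 0 < minor_sq.
Proof. by rewrite subr_gt0 sqr_cmod. Qed.

Lemma width_sq_gt0 (t : R) : 0 < width_sq t.
Proof. by rewrite width_sqE ltr_wpDr ?sqr_ge0 // minor_sq_gt0. Qed.

Lemma disk_quad (w : R[i]) :
  ellipse_disk E w <-> ellipse_quad w <= (major E / 2) ^+ 2 * minor_sq.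
Proof.
rewrite /ellipse_disk /ellipse_quad /=.
have := (sum_dist_le a0 fa (complex.Re (w - ellipse_center E))
          (complex.Im (w - ellipse_center E))).1.
rewrite /minor_sq sqr_cmod focus1E focus2E [2 * (_ / 2)]mulrC mulfVK //.
have -> : forall c f, w - (c + f) = (w - c) - f by move=> *; ring.
have -> : forall c f, w - (c - f) = (w - c) + f by move=> *; ring.
by rewrite !cmodE !ReD !ImD !ReN !ImN.
Qed.

Lemma curve_quad (w : R[i]) :
  ellipse_curve E w <-> ellipse_quad w = (major E / 2) ^+ 2 * minor_sq.
Proof.
rewrite /ellipse_curve (lt_eqF ndE) /ellipse_quad /=.
have := (sum_dist_le a0 fa (complex.Re (w - ellipse_center E))
          (complex.Im (w - ellipse_center E))).2.
rewrite /minor_sq sqr_cmod focus1E focus2E [2 * (_ / 2)]mulrC mulfVK //.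
have -> : forall c f, w - (c + f) = (w - c) - f by move=> *; ring.
have -> : forall c f, w - (c - f) = (w - c) + f by move=> *; ring.
by rewrite !cmodE !ReD !ImD !ReN !ImN.
Qed.

End Ellipse.

Lemma quad_touch (R : comPzRingType) (a fx fy u v : R) :
  let B := a ^+ 2 - (fx ^+ 2 + fy ^+ 2) in
  let g := fx * u + fy * v in
  a ^+ 2 * ((B * u + g * fx) ^+ 2 + (B * v + g * fy) ^+ 2)
  - (fx * (B * u + g * fx) + fy * (B * v + g * fy)) ^+ 2
  = a ^+ 2 * B * (B * (u ^+ 2 + v ^+ 2) + g ^+ 2).
Proof. by move=> B g; rewrite /B /g; ring. Qed.

(** The two linear equations for p = (px, py) are the value h of the normal
    component and the equality case of the Lagrange-type identity; expanding p
    along the normal (c, -s) and the tangent (s, c) solves them. *)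
Lemma touch_unique_algebra (F : fieldType) (B fx fy px py c s h : F) :
  h != 0 -> c ^+ 2 + s ^+ 2 = 1 -> c * px - s * py = h ->
  h ^+ 2 = B + (c * fx - s * fy) ^+ 2 ->
  (B + (fx ^+ 2 + fy ^+ 2)) * (py * c + px * s)
    - (fx * px + fy * py) * (fy * c + fx * s) = 0 ->
  px = (B * c + (c * fx - s * fy) * fx) / h
  /\ py = ((c * fx - s * fy) * fy - B * s) / h.
Proof.
move=> h0 cs pE hE H.
pose q := py * c + px * s; pose g := c * fx - s * fy; pose k := fx * s + fy * c.
have pxE : px = h * c + q * s.
  by rewrite -[LHS]mulr1 -cs -pE /q; ring.
have pyE : py = q * c - h * s.
  by rewrite -[LHS]mulr1 -cs -pE /q; ring.
have fE : fx ^+ 2 + fy ^+ 2 = g ^+ 2 + k ^+ 2.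
  by rewrite -[LHS]mulr1 -cs /g /k; ring.
have qh : q * h = g * k.
  apply: (mulIf h0); apply/eqP; rewrite -subr_eq0; apply/eqP.
  transitivity ((B + g ^+ 2) * q - h * g * k); first by rewrite -hE; ring.
  rewrite -[RHS]H fE -/q -/k.
  have -> : fx * px + fy * py = h * g + q * k.
    by rewrite {1}pxE {1}pyE /g /k; ring.
  by rewrite [fy * c + _]addrC -/k; ring.
split; apply: (mulIf h0); rewrite mulfVK //.
  have -> : px * h = h ^+ 2 * c + (q * h) * s by rewrite {1}pxE; ring.
  by rewrite hE qh -/g -[fx in RHS]mulr1 -cs /g /k; ring.
have -> : py * h = (q * h) * c - h ^+ 2 * s by rewrite {1}pyE; ring.
by rewrite hE qh -/g -[fy in RHS]mulr1 -cs /g /k; ring.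
Qed.

Section Touch.
Variables (R : realType) (E : ellipse R).
Hypothesis ndE : ellipse_nondegenerate E.

Lemma width_sq_pi (t : R) : width_sq E (t + pi) = width_sq E t.
Proof. by rewrite !width_sqE !Re_expi cosDpi sinDpi; ring. Qed.

(** Bounds the normal component of a point of the disk by the support function,
    with equality only where the right-hand side vanishes. *)
Lemma width_quad_dual (w : R[i]) (t : R) :
  let p := w - ellipse_center E in
  let f := half_focal E in
  ellipse_quad E w * width_sq E t
  - (major E / 2) ^+ 2 * minor_sq E * complex.Re (expi t * p) ^+ 2
  = ((major E / 2) ^+ 2 * (complex.Im p * cos t + complex.Re p * sin t)
     - (complex.Re f * complex.Re p + complex.Im f * complex.Im p)
       * (complex.Im f * cos t + complex.Re f * sin t)) ^+ 2.
Proof.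
move=> p f; rewrite width_sqE !Re_expi -/f /ellipse_quad -/p -/f.
have := quad_dual (major E / 2) (complex.Re f) (complex.Im f)
  (complex.Re p) (complex.Im p) (cos t) (- sin t).
rewrite sqrrN cos2Dsin2 mulr1 /minor_sq sqr_cmod -/f.
set a := major E / 2.
move=> H.
transitivity ((a ^+ 2 * (complex.Im p * cos t - complex.Re p * - sin t)
  - (complex.Re f * complex.Re p + complex.Im f * complex.Im p)
    * (complex.Im f * cos t - complex.Re f * - sin t)) ^+ 2); last by ring.
by rewrite -H; ring.
Qed.

Lemma level_gt0 : 0 < (major E / 2) ^+ 2 * minor_sq E.
Proof.
rewrite mulr_gt0 ?minor_sq_gt0 // exprn_gt0 // divr_gt0 //.
by apply: le_lt_trans ndE; exact: cmod_ge0.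
Qed.

Lemma disk_le_support (w : R[i]) (t : R) :
  ellipse_disk E w -> complex.Re (expi t * w) <= ellipse_support E t.
Proof.
move=> /(disk_quad ndE) Qw.
have := width_quad_dual w t; cbv zeta.
set p := w - ellipse_center E; set s := (X in _ = X ^+ 2) => H.
have -> : w = ellipse_center E + p by rewrite addrC subrK.
rewrite mulrDr ReD lerD2l.
apply: le_trans (ler_norm _) _; rewrite -sqrtr_sqr; apply: ler_wsqrtr.
rewrite -(ler_pM2l level_gt0).
apply: le_trans (_ : ellipse_quad E w * width_sq E t <= _).
  by rewrite -subr_ge0 H sqr_ge0.
by rewrite ler_pM2r ?width_sq_gt0.
Qed.

Lemma touch_support (t : R) :
  complex.Re (expi t * touch E t) = ellipse_support E t.
Proof.
rewrite mulrDr ReD /ellipse_support; congr (_ + _).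
rewrite /touch /= !Re_expi /=; have := sqr_sqrtr (ltW (width_sq_gt0 ndE t)).
have : Num.sqrt (width_sq E t) != 0 by rewrite gt_eqF // sqrtr_gt0 width_sq_gt0.
set h := Num.sqrt _ => h0; rewrite width_sqE Re_expi => hE.
apply: (mulIf h0); rewrite -expr2 hE mulrBl !mulrA !mulfVK //.
rewrite -[X in _ = X + _]mulr1 -(cos2Dsin2 t); ring.
Qed.

Lemma touch_curve (t : R) : ellipse_curve E (touch E t).
Proof.
apply/(curve_quad ndE).
have W0 := width_sq_gt0 ndE t.
have hE := sqr_sqrtr (ltW W0).
have h0 : Num.sqrt (width_sq E t) != 0 by rewrite gt_eqF // sqrtr_gt0.
rewrite /ellipse_quad /touch !Re_expi ![ellipse_center E + _]addrC !addrK /=.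
move: hE h0; rewrite {2}width_sqE !Re_expi.
set h := Num.sqrt _ => hE h0.
set f := half_focal E in hE *; set a := major E / 2.
have := quad_touch a (complex.Re f) (complex.Im f) (cos t) (- sin t).
cbv zeta; rewrite sqrrN cos2Dsin2 -sqr_cmod -/(minor_sq E) mulr1 => H.
have h20 : h ^+ 2 != 0 by rewrite expf_neq0.
apply: (mulIf h20); rewrite hE.
transitivity (a ^+ 2 * minor_sq E *
  (minor_sq E + (complex.Re f * cos t + complex.Im f * - sin t) ^+ 2)).
  rewrite -H -hE; field; exact: h0.
by congr (_ * (_ + _)); ring.
Qed.

Lemma touch_disk (t : R) : ellipse_disk E (touch E t).
Proof.
by apply/(disk_quad ndE); have /(curve_quad ndE) -> := touch_curve t.
Qed.

Lemma touch_unique (w : R[i]) (t : R) :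
  ellipse_disk E w -> complex.Re (expi t * w) = ellipse_support E t ->
  w = touch E t.
Proof.
move=> /(disk_quad ndE) Qw; rewrite /ellipse_support.
have W0 := width_sq_gt0 ndE t.
have := width_quad_dual w t; cbv zeta.
have h0 : Num.sqrt (width_sq E t) != 0 by rewrite gt_eqF // sqrtr_gt0.
have hE := sqr_sqrtr (ltW W0).
rewrite /touch; set p := w - ellipse_center E.
have wE : w = ellipse_center E + p by rewrite addrC subrK.
set sq := (X in _ = X ^+ 2) => H.
rewrite {1 2}wE mulrDr ReD => /addrI pE; congr (_ + _).
have {}H : sq = 0.
  apply/eqP; rewrite -sqrf_eq0 eq_le sqr_ge0 andbT.
  by rewrite -H pE hE -mulrBl pmulr_lle0 // subr_le0.
rewrite /sq in H.
move: pE hE h0 H; rewrite width_sqE !Re_expi; set h := Num.sqrt _.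
set f := half_focal E; set a := major E / 2 => pE hE h0 H.
have aE : a ^+ 2 = minor_sq E + (complex.Re f ^+ 2 + complex.Im f ^+ 2).
  by rewrite /minor_sq -sqr_cmod subrK.
have := touch_unique_algebra h0 (cos2Dsin2 t) pE hE _.
rewrite -aE => /(_ H)[Ex Ey].
by apply/eqP; rewrite eq_complex /= Ex Ey !eqxx.
Qed.

End Touch.

Lemma quad_normal (R : comPzRingType) (a fx fy x y : R) :
  let B := a ^+ 2 - (fx ^+ 2 + fy ^+ 2) in
  let g := fx * x + fy * y in
  let Q := a ^+ 2 * (x ^+ 2 + y ^+ 2) - g ^+ 2 in
  let u := a ^+ 2 * x - g * fx in
  let v := a ^+ 2 * y - g * fy in
  u * x + v * y = Q /\
  B * (u ^+ 2 + v ^+ 2) + (u * fx + v * fy) ^+ 2 = a ^+ 2 * B * Q.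
Proof. by cbv zeta; split; ring. Qed.

Lemma chord_algebra (F : numFieldType) (c w r : F) :
  c + r * (w - c) = 2 * c - w + (1 + r) / 2 * (w - (2 * c - w)).
Proof. by field. Qed.

Section Support.
Variables (R : realType) (E : ellipse R).
Hypothesis ndE : ellipse_nondegenerate E.

(** Half the gradient of the quadratic form at w, the vector (u, v) below, gives
    the normal direction of the level ellipse through w; N is its length. *)
Lemma exists_normal (w : R[i]) : 0 < ellipse_quad E w ->
  exists t N : R,
  [/\ 0 < N, complex.Re (expi t * (w - ellipse_center E)) * N = ellipse_quad E w
    & width_sq E t * N ^+ 2
      = (major E / 2) ^+ 2 * minor_sq E * ellipse_quad E w].
Proof.
set p := w - ellipse_center E; set f := half_focal E; set a := major E / 2.
set Q := ellipse_quad E w.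
pose g := complex.Re f * complex.Re p + complex.Im f * complex.Im p.
pose u := a ^+ 2 * complex.Re p - g * complex.Re f.
pose v := a ^+ 2 * complex.Im p - g * complex.Im f.
have [uv Bn] : u * complex.Re p + v * complex.Im p = Q /\
    minor_sq E * (u ^+ 2 + v ^+ 2) + (u * complex.Re f + v * complex.Im f) ^+ 2
    = a ^+ 2 * minor_sq E * Q.
  by rewrite /minor_sq sqr_cmod; exact: quad_normal.
clearbody u v Q => Q0.
have n0 : 0 < u ^+ 2 + v ^+ 2.
  rewrite lt0r addr_ge0 ?sqr_ge0 // andbT paddr_eq0 ?sqr_ge0 //.
  apply/negP => /andP[]; rewrite !sqrf_eq0 => /eqP u0 /eqP v0.
  by move: Q0; rewrite -uv u0 v0 !mul0r addr0 ltxx.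
pose N := Num.sqrt (u ^+ 2 + v ^+ 2).
have N0 : 0 < N by rewrite sqrtr_gt0.
have NE : N ^+ 2 = u ^+ 2 + v ^+ 2 by rewrite sqr_sqrtr // ltW.
have nz : N != 0 by rewrite gt_eqF.
have [t [ct st]] : exists t, cos t = u / N /\ sin t = - v / N.
  apply: exists_angle; rewrite !exprMn exprVn sqrrN -mulrDl -NE mulfV //.
  by rewrite expf_neq0.
exists t, N; split => //.
  by rewrite Re_expi ct st -uv; field.
rewrite width_sqE Re_expi ct st -Bn -/f.
transitivity (minor_sq E * N ^+ 2 + (u * complex.Re f + v * complex.Im f) ^+ 2).
  by field.
by rewrite NE.
Qed.

Lemma disk_of_support (w : R[i]) :
  (forall t, complex.Re (expi t * w) <= ellipse_support E t) ->
  ellipse_disk E w.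
Proof.
move=> wE; apply/(disk_quad ndE); rewrite leNgt; apply/negP => Qw.
have Q0 := lt_trans (level_gt0 ndE) Qw.
have [t [N [N0 pE WE]]] := exists_normal Q0.
have := wE t; rewrite -[w in X in X -> _](subrK (ellipse_center E)) addrC.
rewrite mulrDr ReD lerD2l => ple.
have : ellipse_quad E w ^+ 2 <= (Num.sqrt (width_sq E t) * N) ^+ 2.
  rewrite ler_pXn2r ?nnegrE ?mulr_ge0 ?sqrtr_ge0 ?(ltW Q0) ?(ltW N0) // -pE.
  by rewrite ler_pM2r.
rewrite exprMn sqr_sqrtr ?(ltW (width_sq_gt0 ndE t)) // WE expr2.
by rewrite ler_pM2r // leNgt Qw.
Qed.

Lemma curve_touch (w : R[i]) : ellipse_curve E w -> exists t, w = touch E t.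
Proof.
move=> /(curve_quad ndE) Qw.
have Q0 : 0 < ellipse_quad E w by rewrite Qw (level_gt0 ndE).
have [t [N [N0 pE WE]]] := exists_normal Q0; exists t.
apply: touch_unique => //; first by apply/(disk_quad ndE); rewrite Qw.
rewrite -[w in LHS](subrK (ellipse_center E)) addrC mulrDr ReD; congr (_ + _).
have NN : N != 0 by rewrite gt_eqF.
apply: (mulIf NN); rewrite pE -[RHS]ger0_norm ?mulr_ge0 ?sqrtr_ge0 ?ltW //.
rewrite -sqrtr_sqr exprMn sqr_sqrtr ?(ltW (width_sq_gt0 ndE t)) // WE -Qw -expr2.
by rewrite sqrtr_sqr gtr0_norm.
Qed.

(** Opposite normals touch at points symmetric about the center. *)
Lemma touch_pi (t : R) : touch E (t + pi) = 2 * ellipse_center E - touch E t.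
Proof.
rewrite /touch width_sq_pi !Re_expi cosDpi sinDpi.
set h := Num.sqrt _; set f := half_focal E; set c := ellipse_center E.
rewrite mulr_natl mulr2n opprD addrA addrK; congr (_ + _).
by apply/eqP; rewrite eq_complex /=; apply/andP; split; apply/eqP; ring.
Qed.

Lemma ellipse_quad_scale (k : R) (p : R[i]) :
  ellipse_quad E (ellipse_center E + k%:C * p)
  = k ^+ 2 * ellipse_quad E (ellipse_center E + p).
Proof.
rewrite /ellipse_quad ![ellipse_center E + _]addrC !addrK.
by case: p => x y /=; ring.
Qed.

Lemma ellipse_quad_gt0 (w : R[i]) :
  w != ellipse_center E -> 0 < ellipse_quad E w.
Proof.
rewrite -subr_eq0 /ellipse_quad; set p := w - _; set f := half_focal E => p0.
have -> : (major E / 2) ^+ 2 * (complex.Re p ^+ 2 + complex.Im p ^+ 2) -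
  (complex.Re f * complex.Re p + complex.Im f * complex.Im p) ^+ 2
  = minor_sq E * (complex.Re p ^+ 2 + complex.Im p ^+ 2)
    + (complex.Re f * complex.Im p - complex.Im f * complex.Re p) ^+ 2.
  by rewrite /minor_sq sqr_cmod -/f; ring.
rewrite ltr_wpDr ?sqr_ge0 // mulr_gt0 ?minor_sq_gt0 //.
rewrite -sqr_cmod exprn_gt0 // lt0r cmod_ge0 andbT.
by apply: contra p0 => /eqP /eq0_normc ->.
Qed.

(** The chord through the center and w; this reduces membership of w in a convex
    set to that of touching points. *)
Lemma disk_chord (w : R[i]) : ellipse_disk E w ->
  exists t (s : R), 0 <= s <= 1 /\
    w = touch E (t + pi) + s%:C * (touch E t - touch E (t + pi)).
Proof.
move=> /(disk_quad ndE) Qw.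
suff [t [r [r01 wE]]] : exists t (r : R), 0 <= r <= 1 /\
    w = ellipse_center E + r%:C * (touch E t - ellipse_center E).
  exists t, ((1 + r) / 2); split; first by move: r01; lra.
  rewrite touch_pi [LHS]wE rmorphM rmorphD /= fmorphV rmorph_nat.
  exact: chord_algebra.
have [->|wc] := eqVneq w (ellipse_center E).
  by exists 0, 0; rewrite lexx ler01 mul0r addr0.
have Q0 := ellipse_quad_gt0 wc.
pose r := Num.sqrt (ellipse_quad E w / ((major E / 2) ^+ 2 * minor_sq E)).
have r0 : 0 < r by rewrite sqrtr_gt0 divr_gt0 // (level_gt0 ndE).
have rE : r ^+ 2 = ellipse_quad E w / ((major E / 2) ^+ 2 * minor_sq E).
  by rewrite sqr_sqrtr // (ltW (divr_gt0 Q0 (level_gt0 ndE))).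
have /curve_touch[t tE] :
    ellipse_curve E (ellipse_center E + (r^-1)%:C * (w - ellipse_center E)).
  apply/(curve_quad ndE); rewrite ellipse_quad_scale [_ + (w - _)]addrC subrK.
  by rewrite exprVn rE invfM invrK mulrAC mulVf ?mul1r // gt_eqF.
exists t, r; split; last first.
  rewrite -tE addrAC subrr add0r mulrA -rmorphM /= mulfV ?gt_eqF //.
  by rewrite mul1r addrC subrK.
rewrite (ltW r0) /= -(ler_pXn2r (n:=2)) ?nnegrE ?(ltW r0) // rE expr1n.
by rewrite ler_pdivrMr ?(level_gt0 ndE) // mul1r.
Qed.

End Support.

Definition is_support (R : realType) (W : set R[i]) (t L : R) : Prop :=
  (forall w, W w -> complex.Re (expi t * w) <= L) /\
  (exists2 w, W w & complex.Re (expi t * w) = L).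

Lemma is_support_unique (R : realType) (W : set R[i]) (t L L' : R) :
  is_support W t L -> is_support W t L' -> L = L'.
Proof.
move=> [le1 [w1 W1 E1]] [le2 [w2 W2 E2]]; apply/le_anti.
by rewrite -{1}E1 -{2}E2 le2 // le1.
Qed.

Lemma ellipse_disk_support (R : realType) (E : ellipse R) (t : R) :
  ellipse_nondegenerate E -> is_support (ellipse_disk E) t (ellipse_support E t).
Proof.
move=> ndE; split=> [w wE|]; first exact: disk_le_support.
by exists (touch E t); [exact: touch_disk | exact: touch_support].
Qed.

(** Every supporting line meets W, and inside the disk it meets only the touching
    point; so W contains the whole boundary, and with it all chords. *)
Lemma convex_ellipse_disk (R : realType) (W : set R[i]) (E : ellipse R) :
  ellipse_nondegenerate E ->
  (forall w1 w2 (s : R), W w1 -> W w2 -> 0 <= s <= 1 ->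
     W (w1 + s%:C * (w2 - w1))) ->
  (forall t, is_support W t (ellipse_support E t)) ->
  W = ellipse_disk E.
Proof.
move=> ndE Wconv Wsupp.
have Wsub w : W w -> ellipse_disk E w.
  by move=> Ww; apply: disk_of_support => // t; exact: (Wsupp t).1.
have Wtouch t : W (touch E t).
  have [_ [w Ww wE]] := Wsupp t.
  by rewrite -(touch_unique ndE (Wsub w Ww) wE).
apply/seteqP; split=> // w /(disk_chord ndE)[t [s [s01 ->]]].
exact: Wconv.
Qed.

(** * Differentiable branches and the Kippenhahn curve *)

(** A differentiable function without a double zero at t has no zero in a
    punctured neighbourhood of t. *)
Lemma near_neq0_of_derivable (R : realType) (d : R -> R) (t : R) :
  derivable d t 1 -> ~ (d t = 0 /\ derive1 d t = 0) ->
  \forall h \near 0^', d (h + t) != 0.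
Proof.
move=> dt nz; have [d0|d0] := eqVneq (d t) 0.
  have dd0 : derive1 d t != 0 by apply/eqP => dd; apply: nz.
  have : (h^-1 *: (d (h + t) - d t)) @[h --> 0^'] --> derive1 d t.
    rewrite derive1E; have := dt; rewrite /derivable /derive /= => cv.
    have -> : (fun h : R => h^-1 *: (d (h + t) - d t))
              = (fun h : R => h^-1 *: (d (h *: 1 + t) - d t)).
      by apply/funext => h; rewrite /GRing.scale /= mulr1.
    exact: cv.
  move=> /cvgr_neq0/(_ dd0); apply: filterS => h; apply: contra => /eqP ->.
  by rewrite d0 subr0 scaler0.
have /continuous_withinNshiftx cd : {for t, continuous d}.
  by apply/differentiable_continuous/derivable1_diffP.
exact: (cvgr_neq0 _ cd d0).
Qed.

(** If f differed from each g i in value or derivative at t, it would differ in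
    value from all of them at points near t. *)
Lemma derivable_select (R : realType) (I : finType) (f : R -> R)
    (g : I -> R -> R) (t : R) :
  derivable f t 1 -> (forall i, derivable (g i) t 1) ->
  (forall s, exists i, f s = g i s) ->
  exists i, f t = g i t /\ derive1 f t = derive1 (g i) t.
Proof.
move=> df dg fg; apply: contrapT => none.
have nearne i : \forall h \near 0^', f (h + t) != g i (h + t).
  have : \forall h \near 0^', (f - g i) (h + t) != 0.
    apply: near_neq0_of_derivable; first exact: derivableB.
    move=> [e1 e2]; apply: none; exists i; split.
      by apply/eqP; rewrite -subr_eq0; apply/eqP.
    move: e2; rewrite !derive1E deriveB // => /eqP.
    by rewrite subr_eq0 => /eqP.
  by apply: filterS => h; rewrite subr_eq0.
have [h hne] := filter_ex (filter_forall _ nearne).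
have [i fgi] := fg (h + t); have := hne i; by rewrite fgi eqxx.
Qed.

Section Branch.
Variables (R : realType) (f : R[i]).
Let g (t : R) : R := complex.Re (expi t * f).

Lemma is_derive_projection (t : R) :
  is_derive t 1 g (- complex.Im (expi t * f)).
Proof.
have -> : g = (fun s => cos s * complex.Re f - sin s * complex.Im f).
  by apply/funext => s; rewrite /g Re_expi.
apply: is_derive_eq.
rewrite /GRing.scale /=; case: f => x y /=; ring.
Qed.

End Branch.

(** Point where the line Re (e^{it} w) = g t touches the envelope of these
    lines. *)
Definition contact (R : realType) (g : R -> R) (t : R) : R[i] :=
  expi (- t) * (g t -i* derive1 g t).

Lemma contact_projection (R : realType) (f : R[i]) (t : R) :
  contact (fun s => complex.Re (expi s * f)) t = f.
Proof.
have [_ gE] := is_derive_projection f t.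
rewrite /contact derive1E gE opprK /expi cosN sinN.
case: f {gE} => x y /=; apply/eqP; rewrite eq_complex /=.
have cs := cos2Dsin2 t; apply/andP; split; apply/eqP.
  by rewrite -[RHS]mulr1 -cs; ring.
by rewrite -[RHS]mulr1 -cs; ring.
Qed.

Lemma contactN (R : realType) (g : R -> R) (t : R) :
  derivable g t 1 -> contact (fun s => - g s) t = - contact g t.
Proof.
move=> dg; rewrite /contact !derive1E.
have -> : 'D_1 (fun s => - g s) t = - 'D_1 g t by exact: deriveN.
by apply/eqP; rewrite eq_complex /=; apply/andP; split; apply/eqP; ring.
Qed.

Lemma is_derive_width (R : realType) (E : ellipse R) (t : R) :
  ellipse_nondegenerate E ->
  is_derive t 1 (fun s => Num.sqrt (width_sq E s))
    (- (complex.Re (expi t * half_focal E) * complex.Im (expi t * half_focal E))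
     / Num.sqrt (width_sq E t)).
Proof.
move=> ndE; have W0 := width_sq_gt0 ndE t.
have dW : is_derive t 1 (width_sq E)
   (- (2 * (complex.Re (expi t * half_focal E)
            * complex.Im (expi t * half_focal E)))).
  have -> : width_sq E
          = (fun s => minor_sq E + complex.Re (expi s * half_focal E) ^+ 2).
    by apply/funext => s; rewrite width_sqE.
  have dg := is_derive_projection (half_focal E) t.
  apply: is_derive_eq.
  rewrite /GRing.scale /=; ring.
have := is_derive1_comp (is_derive1_sqrt W0) dW.
rewrite /comp => dS; apply: is_derive_eq.
by field; rewrite gt_eqF // sqrtr_gt0.
Qed.

Lemma contact_width (R : realType) (E : ellipse R) (t : R) :
  ellipse_nondegenerate E -> ellipse_center E = 0 ->
  contact (fun s => Num.sqrt (width_sq E s)) t = touch E t.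
Proof.
move=> ndE c0; have W0 := width_sq_gt0 ndE t.
have h0 : Num.sqrt (width_sq E t) != 0 by rewrite gt_eqF // sqrtr_gt0.
have hE := sqr_sqrtr (ltW W0).
have [_ dE] := is_derive_width t ndE.
rewrite /contact derive1E dE /touch c0 add0r /expi cosN sinN.
move: hE h0; rewrite {2}width_sqE; set h := Num.sqrt _ => hE h0.
case: (half_focal E) hE => x y /=; set c := cos t; set s := sin t => hE.
have cs : c ^+ 2 + s ^+ 2 = 1 by exact: cos2Dsin2.
have BE : minor_sq E = h ^+ 2 - (c * x - s * y) ^+ 2 by rewrite hE addrK.
apply/eqP; rewrite eq_complex /= BE; apply/andP; split; apply/eqP.
  apply/eqP; rewrite -subr_eq0; apply/eqP.
  transitivity ((c * x - s * y) * x * (c ^+ 2 + s ^+ 2 - 1) / h).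
    by field; exact: h0.
  by rewrite cs subrr mulr0 mul0r.
apply/eqP; rewrite -subr_eq0; apply/eqP.
transitivity ((c * x - s * y) * y * (c ^+ 2 + s ^+ 2 - 1) / h).
  by field; exact: h0.
by rewrite cs subrr mulr0 mul0r.
Qed.

(** In the degenerate case the support function |Re (e^{it} f)| is not
    differentiable, and the signed Re (e^{it} f) replaces it; its lines all pass
    through f.  In the other case a sign change of the branch amounts to
    t |-> t + pi. *)
Lemma ellipse_branch (R : realType) (E : ellipse R) :
  ellipse_possibly_degenerate E -> ellipse_center E = 0 ->
  exists g : R -> R,
  [/\ forall t, derivable g t 1,
      forall t, g t ^+ 2 = width_sq E t &
      forall w, ellipse_curve E w <->
        exists t, w = contact g t \/ w = - contact g t].
Proof.
move=> [fE _] c0; move: (fE); rewrite le_eqVlt => /predU1P[dE|ndE].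
  exists (fun t => complex.Re (expi t * half_focal E)); split.
  - by move=> t; have [] := is_derive_projection (half_focal E) t.
  - move=> t; rewrite width_sqE /minor_sq -dE cmod_focal.
    by rewrite [2 * _]mulrC mulfK ?pnatr_eq0 // subrr add0r.
  - move=> w; rewrite /ellipse_curve dE eqxx focus1E focus2E c0 add0r sub0r /=.
    split=> [[->|->]|[t]].
    + by exists 0; left; rewrite contact_projection.
    + by exists 0; right; rewrite contact_projection.
    + by rewrite contact_projection.
exists (fun t => Num.sqrt (width_sq E t)); split.
- by move=> t; have [] := is_derive_width t ndE.
- by move=> t; rewrite sqr_sqrtr // ltW // width_sq_gt0.
- move=> w; split=> [/(curve_touch ndE)[t ->]|[t]].
    by exists t; left; rewrite contact_width.
  rewrite contact_width // => -[->|->]; first exact: touch_curve.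
  have -> : - touch E t = touch E (t + pi) by rewrite touch_pi c0 mulr0 sub0r.
  exact: touch_curve.
Qed.

(** A differentiable choice of roots agrees to first order, at each t, with one
    of the five branches 0, +-g1, +-g2; conversely each branch is itself a
    differentiable choice of roots. *)
Lemma kippenhahn_two_ellipses (R : realType) (n : nat) (A : 'M[R[i]]_n)
    (E1 E2 : ellipse R) :
  ellipse_possibly_degenerate E1 -> ellipse_center E1 = 0 ->
  ellipse_possibly_degenerate E2 -> ellipse_center E2 = 0 ->
  (forall l t, nrpoly A l t = 0 <->
     l * (l ^+ 2 - width_sq E1 t) * (l ^+ 2 - width_sq E2 t) = 0) ->
  kippenhahn_curve A = [set 0] `|` ellipse_curve E1 `|` ellipse_curve E2.
Proof.
move=> dE1 c1 dE2 c2 AE.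
have [g1 [dg1 g1E C1]] := ellipse_branch dE1 c1.
have [g2 [dg2 g2E C2]] := ellipse_branch dE2 c2.
pose br (k : option (bool * bool)) (s : R) : R :=
  if k is Some (b, e) then
    let x := if b then g1 s else g2 s in if e then - x else x
  else 0.
have dbr k s : derivable (br k) s 1.
  case: k => [[[] []]|]; rewrite /br /=.
  - exact: derivableN.
  - exact: dg1.
  - exact: derivableN.
  - exact: dg2.
  - exact: derivable_cst.
have c0 t : contact (fun=> 0) t = 0 :> R[i].
  rewrite /contact derive1E; have -> : 'D_1 (fun=> 0 : R) t = 0 by exact: derive_cst.
  by rewrite oppr0 mulr0.
have brcurve k t : ([set 0] `|` ellipse_curve E1 `|` ellipse_curve E2)
    (contact (br k) t).
  case: k => [[[] []]|]; rewrite /br /=.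
  - by left; right; apply/C1; exists t; right; rewrite contactN.
  - by left; right; apply/C1; exists t; left.
  - by right; apply/C2; exists t; right; rewrite contactN.
  - by right; apply/C2; exists t; left.
  - by left; left; rewrite c0.
have brroot k s : nrpoly A (br k s) s = 0.
  apply/AE; case: k => [[[] []]|]; rewrite /br /= ?sqrrN ?g1E ?g2E;
  by rewrite ?subrr ?mulr0 ?mul0r.
have brkip k t : kippenhahn_curve A (contact (br k) t).
  by exists (br k), t.
apply/seteqP; split=> w.
  move=> [mu [t [dmu mu0 ->]]].
  (* A value of mu is a root of the polynomial: 0, +-g1 or +-g2. *)
  have [k [mE dE]] : exists k, mu t = br k t /\ derive1 mu t = derive1 (br k) t.
    apply: derivable_select => // s; have /AE/eqP := mu0 s.
    rewrite !mulf_eq0 !subr_eq0 -g1E -g2E !eqf_sqr -!orbA.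
    case/or4P=> [/eqP ->|/eqP ->|/eqP ->|]; first by exists None.
    - by exists (Some (true, false)).
    - by exists (Some (true, true)).
    case/orP=> /eqP ->; first by exists (Some (false, false)).
    by exists (Some (false, true)).
  by rewrite mE dE; exact: brcurve.
case=> [[->|]|].
- by rewrite -(c0 0); exact: (brkip None).
- move=> /C1[t [->|->]]; first exact: (brkip (Some (true, false))).
  by rewrite -contactN //; exact: (brkip (Some (true, true))).
- move=> /C2[t [->|->]]; first exact: (brkip (Some (false, false))).
  by rewrite -contactN //; exact: (brkip (Some (false, true))).
Qed.

Lemma le_sqrt_of_sqr (R : rcfType) (x y : R) : x ^+ 2 <= y -> x <= Num.sqrt y.
Proof.
move=> xy; apply: le_trans (ler_norm _) _.
by rewrite -sqrtr_sqr ler_wsqrtr.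
Qed.

(** For a doubleton {f, -f} the support function is |Re (e^{it} f)|. *)
Lemma curve_le_support (R : realType) (E : ellipse R) (w : R[i]) (t : R) :
  ellipse_possibly_degenerate E -> ellipse_curve E w ->
  complex.Re (expi t * w) <= ellipse_support E t.
Proof.
move=> [fE _]; move: (fE); rewrite le_eqVlt => /predU1P[dE|ndE]; last first.
  move=> /(curve_quad ndE) Qw; apply: disk_le_support => //.
  by apply/(disk_quad ndE); rewrite Qw.
have wf : width_sq E t = complex.Re (expi t * half_focal E) ^+ 2.
  rewrite width_sqE /minor_sq -dE cmod_focal.
  by rewrite [2 * _]mulrC mulfK ?pnatr_eq0 // subrr add0r.
rewrite /ellipse_curve dE eqxx focus1E focus2E /ellipse_support wf => -[->|->];
  rewrite mulrDr ReD lerD2l; apply: le_sqrt_of_sqr; rewrite ?mulrN ?ReN ?sqrrN //.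
Qed.

(** * Supporting lines of the numerical range *)

Lemma numrange_support (R : realType) (n : nat) (A : 'M[R[i]]_n) (t L : R) :
  nrpoly A L t = 0 -> (forall l, nrpoly A l t = 0 -> l <= L) ->
  is_support (numrange A) t L.
Proof.
by move=> L0 Lmax; split; [exact: numrange_Re_le | exact: numrange_eigen].
Qed.

Lemma biquadratic_max_root (R : rcfType) (S T : R) :
  0 <= S -> 0 <= S ^+ 2 - 4 * T ->
  let L := Num.sqrt ((S + Num.sqrt (S ^+ 2 - 4 * T)) / 2) in
  L * (L ^+ 4 - S * L ^+ 2 + T) = 0 /\
  forall l, l * (l ^+ 4 - S * l ^+ 2 + T) = 0 -> l <= L.
Proof.
move=> S0 D0; have := sqr_sqrtr D0; have := sqrtr_ge0 (S ^+ 2 - 4 * T).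
set d := Num.sqrt _ => d0 dE; cbv zeta.
have V0 : 0 <= (S + d) / 2 by rewrite divr_ge0 // addr_ge0.
have TE : T = (S ^+ 2 - d ^+ 2) / 4 by rewrite dE; field.
have fac l : l ^+ 4 - S * l ^+ 2 + T
    = (l ^+ 2 - (S + d) / 2) * (l ^+ 2 - (S - d) / 2) by rewrite TE; field.
split; first by rewrite fac sqr_sqrtr // subrr mul0r mulr0.
move=> l /eqP; rewrite fac !mulf_eq0 !subr_eq0 => /or3P[/eqP->|/eqP e|/eqP e].
- exact: sqrtr_ge0.
- by apply: le_sqrt_of_sqr; rewrite e.
- apply: le_sqrt_of_sqr; rewrite e; move: d0; lra.
Qed.

(** Four times the non-square part of the discriminant, see [discriminantE]. *)
Definition split_defect (R : realType) (A : 'M[R[i]]_5) : R :=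
  (parA A 1 - parA A 4) * (parA A 1 - parA A 4 - 2 * (parA A 3 - parA A 2)).

Lemma nrpoly_eq0 (R : realType) (A : 'M[R[i]]_5) (l t : R) :
  reciprocal A ->
  nrpoly A l t = 0 <->
  l * (l ^+ 4 - edge_sum A t * l ^+ 2 + matching_sum A t) = 0.
Proof.
move=> hA; rewrite nrpoly_reciprocal //; split=> [[/eqP]|->].
  by rewrite oppr_eq0 => /eqP.
by rewrite oppr0.
Qed.

Lemma discriminantE (R : realType) (A : 'M[R[i]]_5) (t : R) :
  edge_sum A t ^+ 2 - 4 * matching_sum A t
  = (cos (2 * t) + (parA A 2 + parA A 3) / 2) ^+ 2 + split_defect A / 4.
Proof. by rewrite /edge_sum /matching_sum /split_defect /offdiag; field. Qed.

Lemma offdiag_ge0 (R : realType) (A : 'M[R[i]]_5) (t : R) (j : nat) :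
  reciprocal A -> (1 <= j <= 4)%N -> 0 <= offdiag A t j.
Proof.
move=> hA j14; rewrite divr_ge0 //.
have := parA_ge1 hA j14; have := cos_geN1 (2 * t); lra.
Qed.

(** The largest eigenvalue of Re (e^{it} A). *)
Definition top_root (R : realType) (A : 'M[R[i]]_5) (t : R) : R :=
  Num.sqrt ((edge_sum A t
             + Num.sqrt (edge_sum A t ^+ 2 - 4 * matching_sum A t)) / 2).

Lemma edge_sum_ge0 (R : realType) (A : 'M[R[i]]_5) (t : R) :
  reciprocal A -> 0 <= edge_sum A t.
Proof. by move=> hA; rewrite !addr_ge0 // offdiag_ge0. Qed.

Lemma discriminant_ge0 (R : realType) (A : 'M[R[i]]_5) (t : R) :
  reciprocal A -> 0 <= edge_sum A t ^+ 2 - 4 * matching_sum A t.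
Proof.
move=> hA; rewrite /edge_sum /matching_sum.
have := mulr_ge0 (offdiag_ge0 t (j := 2) hA isT) (offdiag_ge0 t (j := 3) hA isT).
set p := offdiag A t => p23.
have -> : (p 1 + p 2 + p 3 + p 4) ^+ 2 - 4 * (p 1 * p 3 + p 1 * p 4 + p 2 * p 4)
        = (p 1 + p 2 - p 3 - p 4) ^+ 2 + 4 * (p 2 * p 3) by ring.
by rewrite addr_ge0 ?sqr_ge0 // mulr_ge0.
Qed.

Lemma reciprocal_support (R : realType) (A : 'M[R[i]]_5) (t : R) :
  reciprocal A -> is_support (numrange A) t (top_root A t).
Proof.
move=> hA.
have [L0 Lmax] := biquadratic_max_root (edge_sum_ge0 t hA) (discriminant_ge0 t hA).
apply: numrange_support; first by apply/nrpoly_eq0.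
by move=> l /nrpoly_eq0 l0; apply: Lmax; exact: l0.
Qed.

(** * Elliptical numerical ranges have square discriminant *)

(** Two quadratic polynomials that agree at 1, 0, -1 are equal, so the left one
    is a perfect square and has discriminant zero. *)
Lemma affine_square_coefs (R : realFieldType) (m K al be : R) :
  (forall c : R, (c == 1) || (c == 0) || (c == -1) ->
     c ^+ 2 + m * c + K = (al * c + be) ^+ 2) ->
  4 * K = m ^+ 2.
Proof.
move=> H; have H1 := H 1; have H0 := H 0; have HN := H (-1).
rewrite !eqxx /= ?orbT in H1 H0 HN.
move: (H1 isT) (H0 isT) (HN isT) => {}H1 {}H0 {}HN.
have a1 : al ^+ 2 = 1 by nra.
have mE : m = 2 * al * be by nra.
have KE : K = be ^+ 2 by nra.
rewrite mE KE; transitivity (4 * (al ^+ 2) * be ^+ 2); last by ring.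
by rewrite a1; ring.
Qed.

Lemma top_root_ext (R : realType) (A : 'M[R[i]]_5) (t u : R) :
  cos (2 * t) = cos (2 * u) -> top_root A t = top_root A u.
Proof. by move=> tu; rewrite /top_root /edge_sum /matching_sum /offdiag tu. Qed.

(** The top root has period pi, so the odd summand Re (e^{it} center) of the
    support function vanishes. *)
Lemma elliptical_top_root (R : realType) (A : 'M[R[i]]_5) (E : ellipse R) (t : R) :
  reciprocal A -> ellipse_nondegenerate E -> numrange A = ellipse_disk E ->
  Num.sqrt (width_sq E t) = top_root A t.
Proof.
move=> hA ndE WE.
have supp u : ellipse_support E u = top_root A u.
  apply: (is_support_unique (W := numrange A) (t := u)).
    by rewrite WE; exact: ellipse_disk_support.
  exact: reciprocal_support.
have : top_root A (t + pi) = top_root A t.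
  by apply: top_root_ext; rewrite !cos2E cosDpi sinDpi !sqrrN.
rewrite -!supp /ellipse_support width_sq_pi !Re_expi cosDpi sinDpi; lra.
Qed.

(** The top root is even in t, which removes the sin 2t term of the squared
    support function; what remains shows that the square root of the
    discriminant is affine in cos 2t. *)
Lemma elliptical_split (R : realType) (A : 'M[R[i]]_5) (E : ellipse R) :
  reciprocal A -> ellipse_nondegenerate E -> numrange A = ellipse_disk E ->
  split_defect A = 0.
Proof.
move=> hA ndE WE.
pose S0 := parA A 1 + parA A 2 + parA A 3 + parA A 4.
have sqd t : edge_sum A t ^+ 2 - 4 * matching_sum A t
    = ((2 * ellipse_x E - 2) * cos (2 * t) + (2 * ellipse_z E - S0 / 2)) ^+ 2.
  have V0 u : 0 <= (edge_sum A u
      + Num.sqrt (edge_sum A u ^+ 2 - 4 * matching_sum A u)) / 2.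
    by rewrite divr_ge0 // addr_ge0 ?edge_sum_ge0 ?sqrtr_ge0.
  have sqE u : width_sq E u = (edge_sum A u
      + Num.sqrt (edge_sum A u ^+ 2 - 4 * matching_sum A u)) / 2.
    rewrite -[LHS]sqr_sqrtr ?(ltW (width_sq_gt0 ndE u)) //.
    by rewrite (elliptical_top_root u hA ndE WE) sqr_sqrtr.
  have widthN : width_sq E (- t) = width_sq E t.
    rewrite -[LHS]sqr_sqrtr ?(ltW (width_sq_gt0 ndE _)) //.
    rewrite -[RHS]sqr_sqrtr ?(ltW (width_sq_gt0 ndE _)) //.
    rewrite !(elliptical_top_root _ hA ndE WE); congr (_ ^+ 2).
    by apply: top_root_ext; rewrite mulrN cosN.
  have wE : width_sq E t = ellipse_x E * cos (2 * t) + ellipse_z E.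
    by move: widthN; rewrite /width_sq mulrN cosN sinN; lra.
  rewrite -[LHS]sqr_sqrtr ?discriminant_ge0 //; congr (_ ^+ 2).
  have := sqE t; rewrite wE; set d := Num.sqrt _.
  by rewrite /edge_sum /offdiag /S0; lra.
have : 4 * ((parA A 2 + parA A 3) ^+ 2 / 4 + split_defect A / 4)
       = (parA A 2 + parA A 3) ^+ 2.
  apply: (affine_square_coefs (al := 2 * ellipse_x E - 2)
            (be := 2 * ellipse_z E - S0 / 2)) => c cE.
  have [t ->] : exists t : R, c = cos (2 * t).
    have : c ^+ 2 + (Num.sqrt (1 - c ^+ 2)) ^+ 2 = 1.
      rewrite sqr_sqrtr; first by rewrite addrC subrK.
      by case/orP: cE => [/orP[]|] /eqP ->; rewrite ?expr1n ?expr0n ?sqrrN ?expr1n ?subrr ?subr0.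
    move=> /exists_angle[u [<- _]]; exists (u / 2).
    by rewrite mulrC mulfVK // pnatr_eq0.
  by rewrite -sqd discriminantE; field.
by move=> H; lra.
Qed.

(** When all A_j equal 1, every p_j vanishes at t = pi / 2, so the support
    function is zero there, while the squared one of a non-degenerate ellipse is
    at least the square of the minor semi-axis. *)
Lemma elliptical_nontrivial (R : realType) (A : 'M[R[i]]_5) (E : ellipse R) :
  reciprocal A -> ellipse_nondegenerate E -> numrange A = ellipse_disk E ->
  exists j : nat, (1 <= j <= 4)%N /\ 1 < parA A j.
Proof.
move=> hA ndE WE; apply: contrapT => none.
have A1 j : (1 <= j <= 4)%N -> parA A j = 1.
  move=> j14; apply/le_anti; rewrite parA_ge1 // andbT leNgt.
  by apply/negP => j1; apply: none; exists j.
have cm1 : cos (2 * (pi / 2)) = -1 :> R.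
  by rewrite mulrC mulfVK ?pnatr_eq0 // cospi.
have off0 j : (1 <= j <= 4)%N -> offdiag A (pi / 2) j = 0.
  by move=> j14; rewrite /offdiag A1 // cm1 subrr mul0r.
have := elliptical_top_root (pi / 2) hA ndE WE.
rewrite /top_root /edge_sum /matching_sum !off0 //.
rewrite !(addr0, mulr0, expr0n, subr0, sqrtr0, mul0r) /= => /eqP.
by rewrite gt_eqF // sqrtr_gt0 width_sq_gt0.
Qed.

(** * The two ellipses of the Kippenhahn curve *)

Definition focal_ellipse (R : realType) (f a : R) : ellipse R :=
  Ellipse f%:C (- f)%:C (2 * a).

Lemma focal_ellipse_center (R : realType) (f a : R) :
  ellipse_center (focal_ellipse f a) = 0.
Proof. by rewrite /ellipse_center /= -rmorphD subrr mulr0. Qed.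

Lemma focal_ellipse_half (R : realType) (f a : R) :
  half_focal (focal_ellipse f a) = f%:C.
Proof.
rewrite /half_focal /=.
have -> : f%:C - (- f)%:C = 2 * f%:C by rewrite rmorphN opprK mulr_natl mulr2n.
by rewrite mulrA mulVf ?mul1r // pnatr_eq0.
Qed.

Lemma focal_ellipse_cmod (R : realType) (f a : R) : 0 <= f ->
  cmod (focus1 (focal_ellipse f a) - focus2 (focal_ellipse f a)) = 2 * f.
Proof.
move=> f0; rewrite cmod_focal focal_ellipse_half cmodE /= expr0n addr0.
by rewrite sqrtr_sqr ger0_norm.
Qed.

Lemma focal_ellipse_width (R : realType) (f a t : R) :
  width_sq (focal_ellipse f a) t
  = (a ^+ 2 - f ^+ 2 / 2) + f ^+ 2 / 2 * cos (2 * t).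
Proof.
rewrite width_sqE /minor_sq focal_ellipse_half sqr_cmod Re_expi cos2E sin2cos2 /=.
by field.
Qed.

Lemma focal_ellipse_axis (R : realType) (f a : R) :
  axis_aligned (focal_ellipse f a).
Proof. by left; rewrite /= subrr. Qed.

(** The foci and the major semi-axis a come from the coefficients of the squared
    support function x cos 2t + y sin 2t + z: as y = 0 and x > 0, the foci are
    +-f with f^2 = 2 x, and a^2 = z + x.  Here x = 3/2, and x = 1/2 for the
    inner ellipse. *)
Definition outer_ellipse (R : realType) (A : 'M[R[i]]_5) : ellipse R :=
  focal_ellipse (Num.sqrt 3)
    (Num.sqrt ((parA A 1 + parA A 4) / 4 + (parA A 2 + parA A 3) / 2 + 3 / 2)).

Definition inner_ellipse (R : realType) (A : 'M[R[i]]_5) : ellipse R :=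
  focal_ellipse 1 (Num.sqrt ((parA A 1 + parA A 4) / 4 + 1 / 2)).

Section Split.
Variables (R : realType) (A : 'M[R[i]]_5).
Hypothesis hA : reciprocal A.
Let a1 := parA_ge1 hA (isT : (1 <= 1 <= 4)%N).
Let a2 := parA_ge1 hA (isT : (1 <= 2 <= 4)%N).
Let a3 := parA_ge1 hA (isT : (1 <= 3 <= 4)%N).
Let a4 := parA_ge1 hA (isT : (1 <= 4 <= 4)%N).

Lemma outer_width (t : R) :
  width_sq (outer_ellipse A) t
  = (parA A 1 + parA A 4) / 4 + (parA A 2 + parA A 3) / 2 + 3 / 2 * cos (2 * t).
Proof.
rewrite focal_ellipse_width !sqr_sqrtr //; first by field.
by move: a1 a2 a3 a4; lra.
Qed.

Lemma inner_width (t : R) :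
  width_sq (inner_ellipse A) t = (parA A 1 + parA A 4) / 4 + 1 / 2 * cos (2 * t).
Proof.
rewrite focal_ellipse_width !sqr_sqrtr //; first by field.
by move: a1 a4; lra.
Qed.

Lemma inner_le_outer (t : R) :
  width_sq (inner_ellipse A) t <= width_sq (outer_ellipse A) t.
Proof.
by rewrite inner_width outer_width; move: (cos_geN1 (2 * t)) a2 a3; lra.
Qed.

Lemma inner_possibly_degenerate : ellipse_possibly_degenerate (inner_ellipse A).
Proof.
have s1 : 1 <= Num.sqrt ((parA A 1 + parA A 4) / 4 + 1 / 2).
  by apply: le_sqrt_of_sqr; move: a1 a4; rewrite expr1n; lra.
split; last by rewrite /= mulr_gt0 //; apply: lt_le_trans s1.
by rewrite focal_ellipse_cmod // mulr1 /=; move: s1; lra.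
Qed.

Lemma outer_nondegenerate (j : nat) :
  (1 <= j <= 4)%N -> 1 < parA A j -> ellipse_nondegenerate (outer_ellipse A).
Proof.
move=> j14 aj; rewrite /ellipse_nondegenerate focal_ellipse_cmod ?sqrtr_ge0 //=.
rewrite ltr_pM2l // ltr_sqrt; last by move: a1 a2 a3 a4; lra.
move: a1 a2 a3 a4 aj; case: j j14 => [|[|[|[|[|j]]]]] //= _; lra.
Qed.

Hypothesis split0 : split_defect A = 0.

Lemma nrpoly_split (l t : R) :
  nrpoly A l t = (- (l * (l ^+ 2 - width_sq (outer_ellipse A) t)
                       * (l ^+ 2 - width_sq (inner_ellipse A) t)))%:C.
Proof.
rewrite nrpoly_reciprocal //; congr ((- _)%:C); rewrite -mulrA; congr (_ * _).
have sE : edge_sum A t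
    = width_sq (outer_ellipse A) t + width_sq (inner_ellipse A) t.
  by rewrite outer_width inner_width /edge_sum /offdiag; field.
have mE : matching_sum A t
    = width_sq (outer_ellipse A) t * width_sq (inner_ellipse A) t.
  apply: (mulfI (_ : 4 != 0)); first by rewrite pnatr_eq0.
  have := discriminantE A t; rewrite split0 mul0r addr0 sE outer_width inner_width.
  by lra.
by rewrite sE mE; ring.
Qed.

Lemma split_support (t : R) :
  is_support (numrange A) t (ellipse_support (outer_ellipse A) t).
Proof.
have W0 : 0 <= width_sq (outer_ellipse A) t.
  by rewrite outer_width; move: (cos_geN1 (2 * t)) a1 a2 a3 a4; lra.
rewrite /ellipse_support focal_ellipse_center mulr0 add0r.
apply: numrange_support.
  by rewrite nrpoly_split sqr_sqrtr // subrr mulr0 mul0r oppr0.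
move=> l; rewrite nrpoly_split => -[/eqP].
rewrite oppr_eq0 !mulf_eq0 !subr_eq0 -orbA => /or3P[/eqP->|/eqP e|/eqP e].
- exact: sqrtr_ge0.
- by apply: le_sqrt_of_sqr; rewrite e.
- by apply: le_sqrt_of_sqr; rewrite e inner_le_outer.
Qed.

Lemma split_numrange :
  ellipse_nondegenerate (outer_ellipse A) ->
  numrange A = ellipse_disk (outer_ellipse A).
Proof.
move=> nd; apply: convex_ellipse_disk => // [w1 w2 s|t].
  exact: numrange_convex.
exact: split_support.
Qed.

Lemma inner_in_outer : ellipse_nondegenerate (outer_ellipse A) ->
  ellipse_curve (inner_ellipse A) `<=` ellipse_disk (outer_ellipse A).
Proof.
move=> nd w wi; apply: disk_of_support => // t.
apply: le_trans (curve_le_support t inner_possibly_degenerate wi) _.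
rewrite /ellipse_support !focal_ellipse_center lerD2l.
by rewrite ler_wsqrtr // inner_le_outer.
Qed.

End Split.

Lemma ellipse_factor_centered (R : realType) (E : ellipse R) (l t : R) :
  ellipse_center E = 0 -> ellipse_factor E l t = l ^+ 2 - width_sq E t.
Proof. by move=> c0; rewrite /ellipse_factor c0 mulr0 subr0. Qed.

Theorem theorem8 (R : realType) (A : 'M[R[i]]_5) (hA : reciprocal A) :
  (elliptical (numrange A) <->
     (parA A 1 = parA A 4 \/
      parA A 1 - parA A 4 = 2 * (parA A 3 - parA A 2)) /\
     (exists j : nat, (1 <= j <= 4)%N /\ 1 < parA A j)) /\
  (elliptical (numrange A) ->
     exists Eout Ein : ellipse R,
       (ellipse_nondegenerate Eout /\ numrange A = ellipse_disk Eout) /\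
       ellipse_possibly_degenerate Ein /\
       (ellipse_center Eout = 0 /\ axis_aligned Eout) /\
       (ellipse_center Ein = 0 /\ axis_aligned Ein) /\
       ellipse_curve Ein `<=` ellipse_disk Eout /\
       kippenhahn_curve A = [set 0] `|` ellipse_curve Eout `|` ellipse_curve Ein /\
       (forall lam t : R,
          nrpoly A lam t =
          (- (point_factor 0 lam t * ellipse_factor Eout lam t
              * ellipse_factor Ein lam t))%:C)).
Proof.
have splitP : (parA A 1 = parA A 4 \/
    parA A 1 - parA A 4 = 2 * (parA A 3 - parA A 2)) <-> split_defect A = 0.
  split=> [[e|e]|/eqP].
  - by rewrite /split_defect e subrr mul0r.
  - by rewrite /split_defect e subrr mulr0.
  - by rewrite mulf_eq0 !subr_eq0 => /orP[]/eqP; [left | right].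
have conds : elliptical (numrange A) ->
    split_defect A = 0 /\ exists j : nat, (1 <= j <= 4)%N /\ 1 < parA A j.
  move=> [E ndE WE].
  by split; [exact: elliptical_split WE | exact: elliptical_nontrivial WE].
split.
  split=> [/conds[s0 ex]|[/splitP s0 [j [j14 aj]]]]; first by split=> //; apply/splitP.
  have nd := outer_nondegenerate hA j14 aj.
  by exists (outer_ellipse A) => //; exact: split_numrange.
move=> /conds[s0 [j [j14 aj]]].
have nd := outer_nondegenerate hA j14 aj.
have co := @focal_ellipse_center R.
have nd' : ellipse_possibly_degenerate (outer_ellipse A).
  split; first exact: ltW.
  by apply: le_lt_trans nd; exact: cmod_ge0.
exists (outer_ellipse A), (inner_ellipse A).
split; first by split; last exact: split_numrange.
split; first exact: inner_possibly_degenerate.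
split; first by split; [exact: co | exact: focal_ellipse_axis].
split; first by split; [exact: co | exact: focal_ellipse_axis].
split; first exact: inner_in_outer.
split.
  apply: (kippenhahn_two_ellipses nd' (co _ _)
            (inner_possibly_degenerate hA) (co _ _)).
  move=> l t; rewrite nrpoly_split //; split=> [[/eqP]|->].
    by rewrite oppr_eq0 => /eqP.
  by rewrite oppr0.
move=> l t; rewrite nrpoly_split // !ellipse_factor_centered; [|exact: co..].
by rewrite /point_factor mulr0 subr0.
Qed.
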